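(* Let $\{(U_{k,i}, V_{k,i}); i \geq 1, k \geq 1\}$ be an array of i.i.d. two-dimensional random vectors and let $\{p_n; n \geq 1\}$ be a sequence of positive integers (not necessarily monotone) such that $n/p_n$ is bounded away from $0$ and $\infty$. Let $$T_n = \max_{1 \leq i \neq j \leq p_n} \Big| \sum_{k=1}^n U_{k,i} V_{k,j} \Big|, \quad n \geq 1.$$ (a) If $(EU_{1,1})(EV_{1,1}) = 0$, $(EU_{1,1}^2)(EV_{1,1}^2) = 1$ and $$\sum_{n=1}^{\infty} P\Big(\max_{1 \leq i \neq j \leq n} |U_{1,i} V_{1,j}| \geq \sqrt{n \log n}\Big) < \infty, \qquad ( * )$$ then $$\limsup_{n \to \infty} \frac{T_n}{\sqrt{n \log n}} \leq 2 \quad \text{a.s.}$$ (b) Conversely, if $\limsup_{n \to \infty} T_n/\sqrt{n \log n} < \infty$ a.s., then $(EU_{1,1})(EV_{1,1}) = 0$, $(EU_{1,1}^2)(EV_{1,1}^2) < \infty$ and $( * )$ holds.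
   Context: $\log$ denotes the natural logarithm. *)

(* Defs.v *)
From HB Require Import structures.
From mathcomp Require Import all_boot all_order all_algebra.
From mathcomp Require Import finmap.
From mathcomp Require Import all_classical all_reals all_analysis.
Set Implicit Arguments. Unset Strict Implicit. Unset Printing Implicit Defensive.
Import Order.TTheory GRing.Theory Num.Theory.
Local Open Scope classical_set_scope.
Local Open Scope ring_scope.

(* Indexing convention: U k i, V k i (k i : nat) stand for U_{k+1,i+1}, V_{k+1,i+1}. *)

Definition pairUV {d} {T : measurableType d} {R : realType}
  (U V : nat -> nat -> T -> R) (ki : nat * nat) : T -> R * R :=
  fun t => (U ki.1 ki.2 t, V ki.1 ki.2 t).

Definition iid_array {d} {T : measurableType d} {R : realType}
  (P : probability T R) (U V : nat -> nat -> T -> R) : Prop :=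
  (forall (ki : nat * nat) (A : set (R * R)), measurable A ->
     P (pairUV U V ki @^-1` A) = P (pairUV U V (0, 0)%N @^-1` A)) /\
  (forall (J : {fset (nat * nat)}) (A : nat * nat -> set (R * R)),
     (forall j, measurable (A j)) ->
     P (\bigcap_(j in [set` J]) (pairUV U V j @^-1` A j)) =
     (\prod_(j <- J) P (pairUV U V j @^-1` A j))%E).

(** T_n = max_{1 <= i <> j <= p_n} | sum_{k=1}^n U_{k,i} V_{k,j} |
    (maximum over an empty index set is 0). *)
Definition Tn {T : Type} {R : realType} (U V : nat -> nat -> T -> R)
  (p : nat -> nat) (n : nat) (t : T) : R :=
  \big[Order.max/0]_(i < p n)
    \big[Order.max/0]_(j < p n | i != j) `| \sum_(k < n) U k i t * V k j t |.

Definition Mn {T : Type} {R : realType} (U V : nat -> nat -> T -> R)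
  (n : nat) (t : T) : R :=
  \big[Order.max/0]_(i < n)
    \big[Order.max/0]_(j < n | i != j) `| U 0%N i t * V 0%N j t |.

Definition nrm {R : realType} (n : nat) : R := Num.sqrt (n%:R * ln n%:R).

(* Main.v *)
Require Import Defs.
From HB Require Import structures.
From mathcomp Require Import all_boot all_order all_algebra.
From mathcomp Require Import finmap.
From mathcomp Require Import all_classical all_reals all_analysis.
From mathcomp Require Import measurable_realfun.
From mathcomp Require Import ring lra zify.
Import Order.TTheory GRing.Theory Num.Theory.
Local Open Scope classical_set_scope.
Local Open Scope ring_scope.
Set Implicit Arguments. Unset Strict Implicit. Unset Printing Implicit Defensive.

(** Proof idea.  Put X_k(i,j) = U_{k,i} V_{k,j}; for fixed i <> j these are i.i.d. in k.

    Splitting the columns into blocks gives P(M_{2^(l+r)} >= x) <= 4^(r+1) P(M_{2^l} >= x),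
    so condition ( * ) is equivalent to the summability of 2^k P(M_{2^k} >= nrm(2^(k+s)))
    for one, or for every, shift s.  If neither U nor V vanishes almost surely, this forces
    P(|U| >= nrm(2^(k+s)) / a) = O(4^-k), hence E|U|^3 < oo, and likewise E|V|^3 < oo.

    (a) By ( * ) and Borel-Cantelli the entries |X_k(i,j)| relevant to T_n are eventually below
    eta nrm(n), so the X_k may be truncated there.  With lambda = c nrm(n) / n and c eta <= 1/4
    the third moments give
      P(|sum_{m <= k < n} X_k| >= x nrm(n)) = O(n^(-c x + c^2 (n - m) / (2 n))).
    A union bound over the pairs (i,j) with c = 2 is summable along the grid
    n' = 2^k q, 2^s <= q < 2^(s+1); with c = 10 / eps it is summable over all n for the
    increments from the grid point n' to n, since n - n' <= n / 2^s.

    (b) The entries of row n with columns below min(p_n, p_{n+1}) are bounded by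
    T_n + T_{n+1}.  Rows are independent, so the second Borel-Cantelli lemma yields the dyadic
    condition, hence ( * ) and the third moments.  If EU EV were nonzero, Chebyshev's
    inequality along n = 2^k would contradict T_n = O(nrm(n)). *)

(** The constant 2 is critical: minimizing - c x + c^2 / 2 over c gives the tail n^(- x^2 / 2) for
    one pair of columns, against about n^2 pairs. At x = 2 + eps the choice c = 2 leaves n^(- 2
    eps), which is summable over boundedly many times per dyadic block but, for small eps, not over
    all n; hence the grid. Since [p] need not be monotone, T_n at a grid point does not control T_n
    at later times. The events are therefore indexed by all pairs of columns below a common bound
    2^(k+r), and the increments after a grid point get their own union bound.

    The truncated products are not recentred: their bias and the Taylor remainder are both paid by
    third absolute moments. This is why those moments are sought; tails O(4^-k) at height nrm(2^k)
    do not yield fourth ones.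

    In (b) no moment is assumed. Summability is derived first, from single entries, and produces the
    moments unless U or V vanishes almost surely. In that case the other variable may fail to be
    integrable, and the claims hold because a product of extended reals with 0 is 0. *)

Section real_bounds.
Context {R : realType}.
Implicit Types x y lam L : R.

Lemma series_exp_le_expR (x : R) (n : nat) : 0 <= x ->
  \sum_(0 <= k < n) x ^+ k / k`!%:R <= expR x.
Proof.
move=> x0; apply: (@nondecreasing_cvgn_le _ (series (exp_coeff x))); last first.
  exact: is_cvg_series_exp_coeff.
by apply: nondecreasing_series => k _ _; rewrite /exp_coeff divr_ge0// exprn_ge0.
Qed.

(** In the terms of index i + 3, [(i + 3)!] is replaced by [i!] once [|y| ^+ 3] is taken out, so the
    remainder is again an exponential series. The factor 1/6 lost in this way is harmless. *)
Lemma expR_le_taylor2 (y : R) :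
  expR y <= 1 + y + y ^+ 2 / 2 + `|y| ^+ 3 * expR `|y|.
Proof.
rewrite {1}/expR; apply: limr_le; first exact: is_cvg_series_exp_coeff.
exists 3%N => // n /= n3; rewrite -(subnKC n3) /series /= big_mkord big_split_ord /=.
rewrite !big_ord_recl big_ord0 /= /exp_coeff /= !fact0 addr0.
have -> : (bump 0 0)`! = 1%N by [].
have -> : (bump 0 (bump 0 0))`! = 2%N by [].
rewrite expr0 /bump /= expr1 !divr1 -!addrA !lerD2l.
rewrite (@le_trans _ _ (`|y| ^+ 3 * \sum_(i < (n - 3)%N) `|y| ^+ i / i`!%:R))//.
  rewrite mulr_sumr; apply: ler_sum => i _.
  rewrite (le_trans (ler_norm _))// normrM normrX normfV (ger0_norm (ler0n _ _)).
  rewrite exprD -mulrA ler_wpM2l ?exprn_ge0// ler_wpM2l ?exprn_ge0//.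
  rewrite lef_pV2 ?posrE ?ltr0n ?fact_gt0// ler_nat.
  by apply: leq_fact; rewrite leq_addl.
rewrite ler_wpM2l ?exprn_ge0//.
by have := series_exp_le_expR (n - 3) (normr_ge0 y); rewrite big_mkord.
Qed.

(** The linear term keeps the untruncated [x], whose mean will vanish. The price is paid where
    [|x| > L]: there the left side is 1, and [lam * |x| <= lam / L ^+ 2 * |x| ^+ 3] offsets a
    negative [lam * x]. *)
Lemma expR_truncated_le (lam L x : R) : 0 < lam -> 0 < L ->
  expR (lam * (if `|x| <= L then x else 0)) <=
  1 + lam * x + lam / L ^+ 2 * `|x| ^+ 3 + lam ^+ 2 / 2 * x ^+ 2 +
  lam ^+ 3 * expR (lam * L) * `|x| ^+ 3.
Proof.
move=> l0 L0.
have x3 : 0 <= `|x| ^+ 3 by rewrite exprn_ge0.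
have t1 : 0 <= lam / L ^+ 2 * `|x| ^+ 3.
  by apply: mulr_ge0 => //; apply: divr_ge0; rewrite ltW ?exprn_gt0.
have t3 : 0 <= lam ^+ 3 * expR (lam * L) * `|x| ^+ 3.
  by apply: mulr_ge0 => //; rewrite mulr_ge0 ?expR_ge0// exprn_ge0// ltW.
case: ifPn => [xL|]; last first.
  rewrite -ltNge => Lx; rewrite mulr0 expR0.
  have x0 : 0 < `|x| by exact: lt_trans Lx.
  have : lam * `|x| <= lam / L ^+ 2 * `|x| ^+ 3.
    rewrite -mulrA ler_pM2l// [leRHS]mulrC ler_pdivlMr ?exprn_gt0//.
    by rewrite [leRHS]exprS ler_pM2l// ler_pXn2r// ?nnegrE ltW.
  have : - (lam * `|x|) <= lam * x by rewrite -mulrN ler_pM2l// lerNl -normrN ler_norm.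
  have : 0 <= lam ^+ 2 / 2 * x ^+ 2 by rewrite mulr_ge0 ?sqr_ge0// divr_ge0 ?sqr_ge0.
  by move: t3; lra.
apply: (le_trans (expR_le_taylor2 _)).
rewrite normrM (gtr0_norm l0) !exprMn.
have : lam ^+ 3 * `|x| ^+ 3 * expR (lam * `|x|) <= lam ^+ 3 * expR (lam * L) * `|x| ^+ 3.
  rewrite [leRHS]mulrAC ler_wpM2l//; first by rewrite mulr_ge0// exprn_ge0 ?ltW.
  by rewrite ler_expR ler_pM2l.
by move: t1; lra.
Qed.

End real_bounds.

(** * Cylinder sigma-algebras and independence *)

Section cylinders.
Context {d' : measure_display} {T : pointedType} {S : measurableType d'} {I : choiceType}
  (Z : I -> T -> S).

(** [T] carries no sigma-algebra here, because the same notion serves on the probability space and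
    on the sequence space [nat -> S]. *)
Definition cylinders (K : set I) : set (set T) :=
  [set E | exists (J : {fset I}) (A : I -> set S),
    [/\ [set` J] `<=` K, forall j, measurable (A j) &
        E = \bigcap_(j in [set` J]) (Z j @^-1` A j)]].

Lemma cylinders_setI (K : set I) : setI_closed (cylinders K).
Proof.
move=> _ _ [J1 [A1 [J1K mA1 ->]]] [J2 [A2 [J2K mA2 ->]]].
exists (J1 `|` J2)%fset, (fun j => (if j \in J1 then A1 j else setT) `&`
  (if j \in J2 then A2 j else setT)); split.
- move=> j /=; rewrite inE => /orP[jJ|jJ]; [exact: J1K|exact: J2K].
- by move=> j; apply: measurableI; case: ifP.
- apply/seteqP; split => t.
    by move=> [h1 h2] j /= _; split; case: ifPn => // jJ; [exact: h1|exact: h2].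
  move=> h; split => j /= jJ.
    by have := h j; rewrite /= inE jJ => /(_ isT) [].
  by have := h j; rewrite /= inE jJ orbT => /(_ isT) [].
Qed.

Lemma cylinders_setT (K : set I) : cylinders K setT.
Proof.
exists fset0, (fun=> setT); split => //.
by apply/seteqP; split => // t _ j /=; rewrite inE.
Qed.

Lemma cylinders_coordinate (K : set I) (j : I) (A : set S) :
  K j -> measurable A -> cylinders K (Z j @^-1` A).
Proof.
move=> Kj mA; exists [fset j]%fset, (fun=> A); split => //.
  by move=> i /=; rewrite inE => /eqP ->.
apply/seteqP; split => [t ZA i /=|t h]; first by rewrite inE => /eqP ->.
by apply: (h j); rewrite /= inE.
Qed.

(** Phrased as measurability for the generated sigma-algebra, so that the closure lemmas for sums,
    products and compositions apply directly. *)
Definition generated_by (K : set I) {d2} {S2 : measurableType d2} (X : T -> S2) :=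
  measurable_fun (setT : set (g_sigma_algebraType (cylinders K))) X.

Lemma generated_byP {d2} {S2 : measurableType d2} (K : set I) (X : T -> S2) (B : set S2) :
  generated_by K X -> measurable B -> <<s cylinders K >> (X @^-1` B).
Proof. by move=> mX mB; rewrite -[X in <<s _ >> X]setTI; exact: mX. Qed.

Lemma generated_by_coordinate (K : set I) (j : I) : K j -> generated_by K (Z j).
Proof.
by move=> Kj _ A mA; rewrite setTI; apply: sub_sigma_algebra; exact: cylinders_coordinate.
Qed.

Lemma generated_by_sub {d2} {S2 : measurableType d2} (K L : set I) (X : T -> S2) :
  K `<=` L -> generated_by K X -> generated_by L X.
Proof.
move=> KL gX _ B mB; rewrite setTI.
have := generated_byP gX mB.
apply: sub_smallest2r; first exact: smallest_sigma_algebra.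
by move=> _ [J [A [JK mA ->]]]; exists J, A; split => // j /JK /KL.
Qed.

End cylinders.

Section independence.
Context {d d' : measure_display} {T : measurableType d} {S : measurableType d'}
  {R : realType} {I : choiceType} (P : probability T R) (Z : I -> T -> S).

Definition mutually_independent :=
  forall (J : {fset I}) (A : I -> set S), (forall j, measurable (A j)) ->
    P (\bigcap_(j in [set` J]) (Z j @^-1` A j)) =
    (\prod_(j <- J) P (Z j @^-1` A j))%E.

Hypothesis mZ : forall j, measurable_fun setT (Z j).

Lemma cylinders_measurable (K : set I) : cylinders Z K `<=` measurable.
Proof.
move=> _ [J [A [_ mA ->]]]; apply: fin_bigcap_measurable => // j _.
by rewrite -[X in measurable X]setTI; exact: mZ.
Qed.

Lemma sigma_cylinders_measurable (K : set I) : <<s cylinders Z K >> `<=` measurable.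
Proof.
apply: smallest_sub; [exact: sigma_algebra_measurable|exact: cylinders_measurable].
Qed.

(** The Dynkin class of the pi-lambda argument: proper differences are handled by subtracting finite
    probabilities, increasing unions by continuity from below. *)
Lemma lambda_system_independent (D : set T) : measurable D ->
  lambda_system setT
    [set E | measurable E /\ P (E `&` D) = (P E * P D)%E].
Proof.
move=> mD; split => //.
- by split => //; rewrite setTI probability_setT mul1e.
- move=> E F FE [mE PE] [mF PF]; split; first exact: measurableD.
  have fP B : measurable B -> P B \is a fin_num by move=> ?; exact: fin_num_measure.
  have -> : (E `\` F) `&` D = (E `&` D) `\` (F `&` D).
    by apply/seteqP; split => t /=; tauto.
  have PD A B : measurable A -> measurable B -> (P (A `\` B) = P A - P (A `&` B))%E.
    by move=> mA mB; apply: measureD => //; rewrite ltey_eq fP.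
  rewrite PD; [|exact: measurableI..]; rewrite PD//.
  have -> : E `&` D `&` (F `&` D) = F `&` D.
    by apply/seteqP; split => t /=; [tauto|move=> [Ft Dt]; have := FE _ Ft].
  by rewrite PE PF (setIidr FE) muleBl// ?fP// fin_num_adde_defr// fP.
- move=> F ndF hF.
  have mF n : measurable (F n) by have [] := hF n.
  split; first exact: bigcupT_measurable.
  transitivity (limn (fun n => P (F n `&` D))).
    rewrite setI_bigcupl; apply/esym/cvg_lim => //.
    apply: nondecreasing_cvg_mu.
    + by move=> n; exact: measurableI.
    + by apply: bigcupT_measurable => n; exact: measurableI.
    + by move=> m n mn; apply/subsetPset; apply: setSI; exact/subsetPset/ndF.
  under eq_fun do rewrite (hF _).2.
  apply/cvg_lim => //; apply: cvgeZr; first exact: fin_num_measure.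
  by apply: nondecreasing_cvg_mu => //; exact: bigcupT_measurable.
Qed.

Hypothesis iZ : mutually_independent.

Lemma cylinders_independent (K L : set I) (E D : set T) : K `&` L = set0 ->
  cylinders Z K E -> cylinders Z L D -> P (E `&` D) = (P E * P D)%E.
Proof.
move=> KL [J1 [A1 [J1K mA1 ->]]] [J2 [A2 [J2L mA2 ->]]].
pose A j := if j \in J1 then A1 j else A2 j.
have mA j : measurable (A j) by rewrite /A; case: ifP.
have dJ j : j \in J1 -> j \in J2 -> False.
  by move=> j1 j2; have : (K `&` L) j by [split; [exact: J1K|exact: J2L]]; rewrite KL.
have -> : (\bigcap_(j in [set` J1]) (Z j @^-1` A1 j)) `&`
    (\bigcap_(j in [set` J2]) (Z j @^-1` A2 j)) =
    \bigcap_(j in [set` (J1 `|` J2)%fset]) (Z j @^-1` A j).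
  apply/seteqP; split => t.
    move=> [h1 h2] j /=; rewrite inE /A => jJ; case: ifPn => j1; first exact: h1.
    by apply: h2 => /=; rewrite (negPf j1) in jJ.
  move=> h; split => j /= jJ.
    by have := h j; rewrite /A /= inE jJ => /(_ isT).
  have := h j; rewrite /A /= inE jJ orbT => /(_ isT).
  by case: ifPn => // j1; case: (dJ j).
have J12 : perm_eq (J1 `|` J2)%fset ((J1 : seq I) ++ J2).
  apply: uniq_perm => //; last by move=> j; rewrite mem_cat inE.
  rewrite cat_uniq !fset_uniq/= andbT; apply/hasPn => j j2.
  by apply/negP => j1; exact: (dJ j).
rewrite !iZ// (perm_big _ J12) big_cat /=.
congr (_ * _)%E; rewrite big_seq [RHS]big_seq; apply: eq_bigr => j jJ.
  by rewrite /A jJ.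
by rewrite /A; case: ifPn => // j1; case: (dJ j).
Qed.

(** The pi-lambda theorem is used twice through [half]: it passes from cylinders to [E] with [D]
    fixed, and its premise, a cylinder against [D], is obtained by passing from cylinders to [D]. *)
Lemma sigma_cylinders_independent (K L : set I) (E D : set T) : K `&` L = set0 ->
  <<s cylinders Z K >> E -> <<s cylinders Z L >> D -> P (E `&` D) = (P E * P D)%E.
Proof.
move=> KL sE sD.
have half (K' L' : set I) (F : set T) : measurable F ->
    (forall G, cylinders Z K' G -> P (G `&` F) = (P G * P F)%E) ->
    forall G, <<s cylinders Z K' >> G -> P (G `&` F) = (P G * P F)%E.
  move=> mF h G sG.
  suff : [set E | measurable E /\ P (E `&` F) = (P E * P F)%E] G by case.
  apply: (lambda_system_subset (@cylinders_setI _ _ _ _ Z K') (lambda_system_independent mF) _ _ sG) => //.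
  by move=> B cB; split; [exact: cylinders_measurable cB|exact: h].
apply: (half K L D _ _ _ sE); first exact: sigma_cylinders_measurable sD.
move=> G cG; rewrite setIC muleC.
apply: (half L K G _ _ _ sD); first exact: cylinders_measurable cG.
by move=> H cH; rewrite setIC muleC; exact: (cylinders_independent KL).
Qed.

Lemma generated_by_measurable {d2} {S2 : measurableType d2} (K : set I) (X : T -> S2) :
  generated_by Z K X -> measurable_fun setT X.
Proof.
move=> gX _ B mB; rewrite setTI; apply: (@sigma_cylinders_measurable K).
exact: generated_byP.
Qed.

Lemma generated_by_independent {d2 d3} {S2 : measurableType d2} {S3 : measurableType d3}
    (K L : set I) (X : T -> S2) (Y : T -> S3) (A : set S2) (B : set S3) :
  K `&` L = set0 -> generated_by Z K X -> generated_by Z L Y ->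
  measurable A -> measurable B ->
  P (X @^-1` A `&` Y @^-1` B) = (P (X @^-1` A) * P (Y @^-1` B))%E.
Proof.
by move=> KL gX gY mA mB; apply: (sigma_cylinders_independent KL); exact: generated_byP.
Qed.

End independence.

(** * Means of integrable random variables *)

Section means.
Context {d : measure_display} {T : measurableType d} {R : realType} (P : probability T R).
Implicit Types (X Y : T -> R) (A B : set T).

Definition prob A : R := fine (P A).
Definition L1 X := P.-integrable setT (EFin \o X).
Definition mean X : R := \int[P]_t X t.

Lemma probE A : measurable A -> P A = (prob A)%:E.
Proof. by move=> mA; rewrite /prob fineK// fin_num_measure. Qed.

Lemma prob_ge0 A : 0 <= prob A.
Proof. by rewrite /prob fine_ge0. Qed.

Lemma prob_le A B : measurable A -> measurable B -> A `<=` B -> prob A <= prob B.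
Proof.
by move=> mA mB AB; rewrite -lee_fin -!probE//; apply: le_measure; rewrite ?inE.
Qed.

Lemma prob_le1 A : measurable A -> prob A <= 1.
Proof. by move=> mA; rewrite -lee_fin -probE//; exact: probability_le1. Qed.

Lemma prob_setC A : measurable A -> prob (~` A) = 1 - prob A.
Proof.
move=> mA; apply: EFin_inj; rewrite -probE; last exact: measurableC.
by rewrite probability_setC// EFinB -probE.
Qed.

Lemma prob_setU_le A B : measurable A -> measurable B ->
  prob (A `|` B) <= prob A + prob B.
Proof.
move=> mA mB; rewrite -lee_fin EFinD -!probE//; last exact: measurableU.
exact: measureU2.
Qed.

Lemma measurable_exists_lt (F : nat -> set T) (n : nat) :
  (forall i, (i < n)%N -> measurable (F i)) ->
  measurable [set t | exists2 i, (i < n)%N & F i t].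
Proof. by move=> mF; exact: (fin_bigcup_measurable (finite_II n) mF). Qed.

Lemma prob_exists_lt_le (F : nat -> set T) (n : nat) (c : R) :
  (forall i, (i < n)%N -> measurable (F i)) ->
  (forall i, (i < n)%N -> prob (F i) <= c) ->
  prob [set t | exists2 i, (i < n)%N & F i t] <= n%:R * c.
Proof.
move=> mF hF; rewrite -lee_fin -probE; last exact: measurable_exists_lt.
have -> : [set t | exists2 i, (i < n)%N & F i t] = \big[setU/set0]_(i < n) F i.
  by rewrite -bigcup_mkord.
apply: (le_trans (Boole_inequality _ mF)).
rewrite (eq_bigr (fun i : 'I_n => (prob (F i))%:E)) => [|i _]; last first.
  by apply: probE; apply: mF.
rewrite sumEFin lee_fin; apply: (@le_trans _ _ (\sum_(i < n) c)).
  by apply: ler_sum => i _; exact: hF.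
by rewrite sumr_const card_ord mulr_natl.
Qed.

Lemma L1_measurable X : L1 X -> measurable_fun setT X.
Proof. by move=> /measurable_int /measurable_EFinP. Qed.

Lemma L1_le X Y : measurable_fun setT X -> L1 Y -> (forall t, `|X t| <= `|Y t|) -> L1 X.
Proof.
move=> mX iY XY; apply: le_integrable iY => //; first exact/measurable_EFinP.
by move=> t _ /=; rewrite lee_fin.
Qed.

Lemma L1_cst (c : R) : L1 (fun=> c).
Proof. exact: finite_measure_integrable_cst. Qed.

Lemma L1D X Y : L1 X -> L1 Y -> L1 (fun t => X t + Y t).
Proof. by move=> iX iY; apply: eq_integrable (integrableD measurableT iX iY). Qed.

Lemma L1Z (c : R) X : L1 X -> L1 (fun t => c * X t).
Proof. by move=> iX; apply: eq_integrable (integrableZl measurableT c iX). Qed.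

Lemma mean_cst (c : R) : mean (fun=> c) = c.
Proof. rewrite /mean Rintegral_cst// [X in fine X](_ : _ = 1%E) ?mulr1//.
exact: probability_setT. Qed.

Lemma meanD X Y : L1 X -> L1 Y -> mean (fun t => X t + Y t) = mean X + mean Y.
Proof. exact: RintegralD. Qed.

Lemma meanZ (c : R) X : L1 X -> mean (fun t => c * X t) = c * mean X.
Proof. exact: RintegralZl. Qed.

Lemma mean_le X Y : L1 X -> L1 Y -> (forall t, X t <= Y t) -> mean X <= mean Y.
Proof. by move=> iX iY XY; apply: le_Rintegral. Qed.

Lemma mean_ge0 X : (forall t, 0 <= X t) -> 0 <= mean X.
Proof. by move=> X0; apply: Rintegral_ge0. Qed.

Lemma integral_mean X : L1 X -> (\int[P]_t (X t)%:E = (mean X)%:E)%E.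
Proof. by move=> iX; rewrite /mean /Rintegral fineK//; exact: integrable_fin_num. Qed.

Lemma measurable_ge X (c : R) : measurable_fun setT X -> measurable [set t | c <= X t].
Proof.
move=> mX; rewrite [X in measurable X](_ : _ = X @^-1` `[c, +oo[%classic).
  by rewrite -[X in measurable X]setTI; apply: mX.
by apply/seteqP; split => t /=; rewrite in_itv/= andbT.
Qed.

Lemma mean_markov X (a : R) : 0 < a -> L1 X -> (forall t, 0 <= X t) ->
  prob [set t | a <= X t] <= mean X / a.
Proof.
move=> a0 iX X0; rewrite ler_pdivlMr//.
have mX := L1_measurable iX; have mA := measurable_ge a mX.
pose Y t : R := a * \1_[set t | a <= X t] t.
have iY1 : L1 \1_[set t | a <= X t] by exact: integrable_indic.
have <- : mean Y = prob [set t | a <= X t] * a.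
  by rewrite /Y meanZ// mulrC /mean /Rintegral integral_indic// setIT.
apply: mean_le => //; first exact: L1Z.
move=> t; rewrite /Y indicE; case: (boolP (t \in _)) => [|_]; last by rewrite mulr0.
by rewrite inE /= mulr1.
Qed.

Section product.
Variables X Y : T -> R.
Hypotheses (iX : L1 X) (iY : L1 Y).
Hypothesis XY : forall A B : set R, measurable A -> measurable B ->
  P (X @^-1` A `&` Y @^-1` B) = (P (X @^-1` A) * P (Y @^-1` B))%E.

Let mX := L1_measurable iX.
Let mY := L1_measurable iY.
Let rX : {RV P >-> R} := HB.pack X (isMeasurableFun.Build _ _ _ _ X mX).
Let rY : {RV P >-> R} := HB.pack Y (isMeasurableFun.Build _ _ _ _ Y mY).
Let mXY : measurable_fun setT (fun t => (X t, Y t)).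
Proof. exact: measurable_fun_pair. Qed.
Let muX := distribution P rX.
Let muY := distribution P rY.

(** A product measure is determined by its values on rectangles, where the claim is the hypothesis
    [XY]. Integrals over the joint law can then be iterated by Tonelli and Fubini. *)
Let law_pair (C : set (R * R)) : measurable C ->
  (muX \x muY)%E C = pushforward P (fun t => (X t, Y t)) C.
Proof.
apply: (product_measure_unique (m' := pushforward P (fun t => (X t, Y t)))) => A B mA mB.
by rewrite /pushforward -XY.
Qed.

Let mprod : measurable_fun setT (fun z : R * R => (z.1 * z.2)%:E).
Proof.
apply/measurable_EFinP; apply: measurable_funM; [exact: measurable_fst|exact: measurable_snd].
Qed.

Let integrable_law (W : {RV P >-> R}) : L1 W -> (distribution P W).-integrable setT EFin.
Proof.
move=> iW; apply/integrableP; split; first exact/measurable_EFinP.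
rewrite (ge0_integral_distribution W (f := fun y => `|y%:E|%E))//.
  by have /integrableP[] := iW.
exact/measurableT_comp/measurable_EFinP.
Qed.

Lemma L1_mul_independent : L1 (fun t => X t * Y t).
Proof.
apply/integrableP; split; first by apply/measurable_EFinP; exact: measurable_funM.
have -> : (\int[P]_t `|((X t * Y t)%R)%:E| =
   \int[pushforward P (fun t => (X t, Y t))]_z `|((z.1 * z.2)%R)%:E|)%E.
  rewrite ge0_integral_pushforward//.
  by apply: measurableT_comp.
rewrite (eq_measure_integral (muX \x muY)%E); last by move=> A mA _; exact/esym/law_pair.
rewrite fubini_tonelli1//; last by apply: measurableT_comp.
have iaX := integrable_abse (@integrable_law rX iX : (distribution P rX).-integrable setT EFin).
have iaY := integrable_abse (@integrable_law rY iY : (distribution P rY).-integrable setT EFin).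
rewrite (eq_integral (fun x : R => `|x%:E| * \int[muY]_y `|y%:E|)%E); last first.
  move=> x _; rewrite /fubini_F -ge0_integralZl//=.
    by apply: eq_integral => y _; rewrite /= normrM.
  by apply: measurableT_comp => //; exact/measurable_EFinP.
have /fineK <- : (\int[muY]_y `|y%:E|)%E \is a fin_num by exact: integrable_fin_num.
rewrite ge0_integralZr//; last 2 first.
  by apply: measurableT_comp => //; exact/measurable_EFinP.
  by rewrite lee_fin fine_ge0// integral_ge0.
have /fineK <- : (\int[muX]_y `|y%:E|)%E \is a fin_num by exact: integrable_fin_num.
by rewrite -EFinM ltry.
Qed.

Lemma mean_mul_independent : mean (fun t => X t * Y t) = mean X * mean Y.
Proof.
apply: EFin_inj; rewrite -integral_mean; last exact: L1_mul_independent.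
transitivity (\int[pushforward P (fun t => (X t, Y t))]_z ((z.1 * z.2)%R)%:E)%E.
  rewrite integral_pushforward// preimage_setT; exact: L1_mul_independent.
rewrite (eq_measure_integral (muX \x muY)%E); last by move=> A mA _; exact/esym/law_pair.
rewrite -integral12_prod_meas1; last first.
  apply/integrableP; split => //.
  rewrite (eq_measure_integral (pushforward P (fun t => (X t, Y t)))); last first.
    by move=> A mA _; exact: law_pair.
  rewrite ge0_integral_pushforward//; last exact: measurableT_comp.
  by have /integrableP[] := L1_mul_independent.
have iLX : muX.-integrable setT EFin := @integrable_law rX iX.
have iLY : muY.-integrable setT EFin := @integrable_law rY iY.
have EX : (\int[muX]_x x%:E = (mean X)%:E)%E.
  by rewrite integral_distribution// -integral_mean.
have EY : (\int[muY]_x x%:E = (mean Y)%:E)%E.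
  by rewrite integral_distribution// -integral_mean.
rewrite (eq_integral (fun x : R => (mean Y)%:E * x%:E)%E); last first.
  move=> x _; rewrite /fubini_F; under eq_integral do rewrite EFinM.
  by rewrite integralZl// EY muleC.
by rewrite integralZl// EX -EFinM mulrC.
Qed.

End product.
End means.

(** * Sums of independent variables *)

Section independent_sums.
Context {d d' : measure_display} {T : measurableType d} {S : measurableType d'}
  {R : realType} {I : choiceType} (P : probability T R) (Z : I -> T -> S).
Hypothesis mZ : forall j, measurable_fun setT (Z j).
Hypothesis iZ : mutually_independent P Z.
Variable K : nat -> set I.
Hypothesis disjointK : forall k l, k != l -> K k `&` K l = set0.

(** [K k] is the set of cells read by the k-th summand. The cells read before step n are disjoint
    from [K n], so a partial sum is independent of the next summand. *)
Let prefix (n : nat) : set I := [set i | exists2 k, (k < n)%N & K k i].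

Let prefix_disjoint n : prefix n `&` K n = set0.
Proof.
apply/seteqP; split => // i [[k kn Ki] Ki'].
by have : (K k `&` K n) i by []; rewrite disjointK// ltn_eqF.
Qed.

Let generated_sum (Y : nat -> T -> R) m n : (forall k, generated_by Z (K k) (Y k)) ->
  generated_by Z (prefix n) (fun t => \sum_(m <= k < n) Y k t).
Proof.
move=> gY; elim: n => [|n IH].
  under eq_fun do rewrite big_geq//; exact: measurable_cst.
have [mn|nm] := leqP m n; last first.
  under eq_fun do rewrite big_geq//; exact: measurable_cst.
under eq_fun do rewrite big_nat_recr//=.
apply: measurable_funD.
  by apply: generated_by_sub IH => i [k kn Ki]; exists k => //; exact: ltnW.
by apply: generated_by_sub (gY n) => i Ki; exists n.
Qed.

Lemma L1_bounded (X : T -> R) (C : R) : measurable_fun setT X ->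
  (forall t, `|X t| <= C) -> L1 P X.
Proof.
move=> mX XC; apply: (L1_le (Y := fun=> C)) => //; first exact: L1_cst.
by move=> t; rewrite (le_trans (XC t))// ler_norm.
Qed.

(** Induction on the number of summands: boundedness makes each exponential integrable, and
    independence from the prefix turns the mean of the product into a product of means. *)
Lemma mean_expR_sum_le (Y : nat -> T -> R) (C theta : R) m n : (m <= n)%N ->
  (forall k, generated_by Z (K k) (Y k)) -> (forall k t, `|Y k t| <= C) ->
  (forall k, mean P (fun t => expR (Y k t)) <= expR theta) ->
  L1 P (fun t => expR (\sum_(m <= k < n) Y k t)) /\
  mean P (fun t => expR (\sum_(m <= k < n) Y k t)) <= expR ((n - m)%:R * theta).
Proof.
move=> mn gY YC Eth; rewrite -(subnKC mn) addKn.
elim: (n - m)%N => [|l [IH1 IH2]].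
  under eq_fun do rewrite addn0 big_geq// expR0.
  by split; [exact: L1_cst|rewrite mean_cst mul0r expR0].
have mexp : measurable_fun setT (@expR R) by exact: measurable_expR.
have iY : L1 P (fun t => expR (Y (m + l)%N t)).
  apply: (L1_bounded (C := expR C)).
    by apply: measurableT_comp => //; exact: generated_by_measurable (gY _).
  by move=> t; rewrite ger0_norm ?expR_ge0// ler_expR (le_trans (ler_norm _)).
have ind (A B : set R) : measurable A -> measurable B ->
    P ((fun t => expR (\sum_(m <= k < m + l) Y k t)) @^-1` A `&`
       (fun t => expR (Y (m + l)%N t)) @^-1` B) =
    (P ((fun t => expR (\sum_(m <= k < m + l) Y k t)%R) @^-1` A) *
     P ((fun t => expR (Y (m + l)%N t)) @^-1` B))%E.
  apply: (generated_by_independent mZ iZ (prefix_disjoint (m + l))).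
    by apply: measurableT_comp => //; exact: generated_sum.
  by apply: measurableT_comp => //; exact: gY.
under eq_fun do rewrite addnS big_nat_recr ?leq_addr//= expRD.
split; first exact: L1_mul_independent.
rewrite mean_mul_independent// -natr1 mulrDl mul1r expRD.
by apply: ler_pM => //; apply: mean_ge0 => t; exact: expR_ge0.
Qed.

Definition trunc (L x : R) := if `|x| <= L then x else 0.

Lemma truncN L x : trunc L (- x) = - trunc L x.
Proof. by rewrite /trunc normrN; case: ifP => // _; rewrite oppr0. Qed.

Lemma trunc_norm_le L x : 0 <= L -> `|trunc L x| <= L.
Proof. by rewrite /trunc; case: ifPn => // _; rewrite normr0. Qed.

Lemma measurable_trunc L : measurable_fun setT (trunc L).
Proof.
apply: measurable_fun_ifT => //.
by apply: measurable_fun_ler.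
Qed.

Definition centered (X : T -> R) (K3 : R) :=
  [/\ L1 P X, L1 P (fun t => X t ^+ 2), L1 P (fun t => `|X t| ^+ 3), mean P X = 0 &
      mean P (fun t => X t ^+ 2) <= 1 /\ mean P (fun t => `|X t| ^+ 3) <= K3].

(** The three terms are the bias caused by truncation, the variance term, and the Taylor remainder
    of [expR_truncated_le] after taking means. *)
Definition exponent (lam L K3 : R) :=
  lam / L ^+ 2 * K3 + lam ^+ 2 / 2 + lam ^+ 3 * expR (lam * L) * K3.

Lemma mean_expR_trunc_le (X : T -> R) (lam L K3 : R) : 0 < lam -> 0 < L ->
  centered X K3 ->
  mean P (fun t => expR (lam * trunc L (X t))) <= expR (exponent lam L K3).
Proof.
move=> l0 L0 [iX iX2 iX3 EX [EX2 EX3]].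
apply: le_trans (expR_ge1Dx _).
have mX := L1_measurable iX.
pose G t := 1 + lam * X t + lam / L ^+ 2 * `|X t| ^+ 3 + lam ^+ 2 / 2 * X t ^+ 2 +
  lam ^+ 3 * expR (lam * L) * `|X t| ^+ 3.
have i1 := L1D (L1_cst P 1) (L1Z lam iX).
have i2 := L1D i1 (L1Z (lam / L ^+ 2) iX3).
have i3 := L1D i2 (L1Z (lam ^+ 2 / 2) iX2).
have i4 := L1D i3 (L1Z (lam ^+ 3 * expR (lam * L)) iX3).
apply: (@le_trans _ _ (mean P G)).
  apply: mean_le => //; last by move=> t; exact: expR_truncated_le.
  apply: (L1_bounded (C := expR (lam * L))).
    apply: measurableT_comp; first exact: measurable_expR.
    by apply: measurable_funM => //; exact: measurableT_comp (measurable_trunc L) _.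
  move=> t; rewrite ger0_norm ?expR_ge0// ler_expR ler_pM2l//.
  exact: le_trans (ler_norm _) (trunc_norm_le _ (ltW L0)).
rewrite /G meanD//; last exact: L1Z.
rewrite meanD//; last exact: L1Z.
rewrite meanD//; last exact: L1Z.
rewrite meanD//; [|exact: L1_cst|exact: L1Z].
rewrite !meanZ// mean_cst EX mulr0 addr0 /exponent -!addrA lerD2l.
rewrite lerD//; first by rewrite ler_wpM2l// divr_ge0 ?exprn_ge0// ltW.
rewrite lerD//.
  by rewrite -[leRHS]mulr1 ler_wpM2l// divr_ge0 ?exprn_ge0// ltW.
by rewrite ler_wpM2l// mulr_ge0 ?expR_ge0// exprn_ge0// ltW.
Qed.

(** Chernoff's method: Markov's inequality for the exponential of [lam] times the sum. *)
Lemma sum_trunc_upper_tail (X : nat -> T -> R) (lam L K3 y : R) m n : (m <= n)%N ->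
  0 < lam -> 0 < L ->
  (forall k, generated_by Z (K k) (X k)) -> (forall k, centered (X k) K3) ->
  prob P [set t | y <= \sum_(m <= k < n) trunc L (X k t)] <=
  expR (- (lam * y) + (n - m)%:R * exponent lam L K3).
Proof.
move=> mn l0 L0 gX cX.
pose Y k t := lam * trunc L (X k t).
have gY k : generated_by Z (K k) (Y k).
  by apply: measurable_funM => //; exact: measurableT_comp (measurable_trunc L) (gX k).
have YC k t : `|Y k t| <= lam * L.
  by rewrite /Y normrM gtr0_norm// ler_pM2l// trunc_norm_le// ltW.
have EY k : mean P (fun t => expR (Y k t)) <= expR (exponent lam L K3).
  exact: mean_expR_trunc_le.
have [iE hE] := mean_expR_sum_le mn gY YC EY.
have -> : [set t | y <= \sum_(m <= k < n) trunc L (X k t)] =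
    [set t | expR (lam * y) <= expR (\sum_(m <= k < n) Y k t)].
  by apply/seteqP; split => t /=; rewrite ler_expR -mulr_sumr ler_pM2l.
apply: (le_trans (mean_markov (expR_gt0 _) iE _)) => [t|]; first exact: expR_ge0.
by rewrite expRD mulrC expRN ler_wpM2l// invr_ge0 expR_ge0.
Qed.

Lemma measurable_sum_trunc (X : nat -> T -> R) (L : R) m n :
  (forall k, generated_by Z (K k) (X k)) ->
  measurable_fun setT (fun t => \sum_(m <= k < n) trunc L (X k t)).
Proof.
move=> gX; apply: measurable_sum => k.
by apply: measurableT_comp (measurable_trunc L) _; exact: generated_by_measurable (gX k).
Qed.

Lemma sum_trunc_tail (X : nat -> T -> R) (lam L K3 y : R) m n : (m <= n)%N ->
  0 < lam -> 0 < L ->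
  (forall k, generated_by Z (K k) (X k)) -> (forall k, centered (X k) K3) ->
  prob P [set t | y <= `|\sum_(m <= k < n) trunc L (X k t)|] <=
  2 * expR (- (lam * y) + (n - m)%:R * exponent lam L K3).
Proof.
move=> mn l0 L0 gX cX.
pose X' k t := - X k t.
have gX' k : generated_by Z (K k) (X' k) by exact: measurableT_comp (gX k).
have cX' k : centered (X' k) K3.
  have [iX iX2 iX3 EX EX23] := cX k; rewrite /X'; split.
  - by under eq_fun do rewrite -mulN1r; exact: L1Z.
  - by under eq_fun do rewrite sqrrN.
  - by under eq_fun do rewrite normrN.
  - by under eq_fun do rewrite -mulN1r; rewrite meanZ// EX mulr0.
  - split; first by under eq_fun do rewrite sqrrN; exact: EX23.1.
    by under eq_fun do rewrite normrN; exact: EX23.2.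
have mS := measurable_sum_trunc L m n gX.
have mS' := measurable_sum_trunc L m n gX'.
rewrite mulr2n mulrDl !mul1r.
apply: (le_trans _ (lerD (sum_trunc_upper_tail y mn l0 L0 gX cX)
  (sum_trunc_upper_tail y mn l0 L0 gX' cX'))).
apply: le_trans (prob_setU_le P (measurable_ge y mS) (measurable_ge y mS')).
apply: prob_le.
- by apply: measurable_ge; exact: measurableT_comp mS.
- by apply: measurableU; exact: measurable_ge.
- move=> t /=; rewrite ler_normr => /orP[?|yS]; [by left|right].
  by rewrite /X'; under eq_bigr do rewrite truncN; rewrite sumrN.
Qed.

(** The cross term vanishes by independence and centering. The induction also carries integrability
    and the zero mean of the partial sum, which that factorization requires. *)
Lemma mean_sum_sq (X : nat -> T -> R) (s2 : R) n :
  (forall k, generated_by Z (K k) (X k)) ->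
  (forall k, [/\ L1 P (X k), L1 P (fun t => X k t ^+ 2), mean P (X k) = 0 &
    mean P (fun t => X k t ^+ 2) <= s2]) ->
  L1 P (fun t => (\sum_(0 <= k < n) X k t) ^+ 2) /\
  mean P (fun t => (\sum_(0 <= k < n) X k t) ^+ 2) <= n%:R * s2.
Proof.
move=> gX hX.
suff [_ _ h3 h4] : [/\ L1 P (fun t => \sum_(0 <= k < n) X k t),
    mean P (fun t => \sum_(0 <= k < n) X k t) = 0,
    L1 P (fun t => (\sum_(0 <= k < n) X k t) ^+ 2) &
    mean P (fun t => (\sum_(0 <= k < n) X k t) ^+ 2) <= n%:R * s2] by [].
elim: n => [|n [i1 e1 i2 e2]].
  split.
  - by under eq_fun do rewrite big_geq//; exact: L1_cst.
  - by under eq_fun do rewrite big_geq//; rewrite mean_cst.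
  - by under eq_fun do rewrite big_geq// expr0n/=; exact: L1_cst.
  - by under eq_fun do rewrite big_geq// expr0n/=; rewrite mean_cst mul0r.
have [iX iX2 EX EX2] := hX n.
have ind (A B : set R) : measurable A -> measurable B ->
    P ((fun t => (\sum_(0 <= k < n) X k t)%R) @^-1` A `&` X n @^-1` B) =
    (P ((fun t => (\sum_(0 <= k < n) X k t)%R) @^-1` A) * P (X n @^-1` B))%E.
  apply: (generated_by_independent mZ iZ (prefix_disjoint n)) (gX n).
  exact: generated_sum.
have iSX := L1_mul_independent i1 iX ind.
have eSX := mean_mul_independent i1 iX ind.
have sq t : (\sum_(0 <= k < n.+1) X k t) ^+ 2 = (\sum_(0 <= k < n) X k t) ^+ 2 +
    2 * ((\sum_(0 <= k < n) X k t) * X n t) + X n t ^+ 2.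
  by rewrite big_nat_recr//= sqrrD mulr_natl.
split.
- by under eq_fun do rewrite big_nat_recr//=; exact: L1D.
- by under eq_fun do rewrite big_nat_recr//=; rewrite meanD// e1 EX addr0.
- under eq_fun do rewrite sq; apply: L1D => //; apply: L1D => //; exact: L1Z.
- under eq_fun do rewrite sq.
  rewrite meanD//; last by apply: L1D => //; exact: L1Z.
  rewrite meanD//; last exact: L1Z.
  rewrite meanZ// eSX EX mulr0 mulr0 addr0 -natr1 mulrDl mul1r.
  exact: lerD.
Qed.

Lemma prob_no_event (A : nat -> set T) n : (forall k, <<s cylinders Z (K k) >> (A k)) ->
  prob P (~` [set t | exists2 k, (k < n)%N & A k t]) = \prod_(0 <= k < n) (1 - prob P (A k)).
Proof.
move=> sA; have mA k : measurable (A k) by exact: sigma_cylinders_measurable (sA k).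
elim: n => [|n IH].
  rewrite big_geq// (_ : ~` _ = setT); last by apply/seteqP; split => // t _ [].
  by rewrite /prob probability_setT.
rewrite big_nat_recr//= -IH.
have -> : ~` [set t | exists2 k, (k < n.+1)%N & A k t] =
    ~` [set t | exists2 k, (k < n)%N & A k t] `&` ~` A n.
  apply/seteqP; split => [t h|t [h1 h2] [k]].
    split => [[k kn Ak]|An]; apply: h; [by exists k => //; exact: leqW|by exists n].
  by rewrite ltnS leq_eqVlt => /predU1P[->//|kn Ak]; apply: h1; exists k.
have mE : measurable [set t | exists2 k, (k < n)%N & A k t].
  exact: measurable_exists_lt.
rewrite -(prob_setC P (mA n)); apply: EFin_inj.
rewrite EFinM -!probE; [|by repeat (apply: measurableI || apply: measurableC)..].
apply: (sigma_cylinders_independent mZ iZ (prefix_disjoint n)).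
  apply: (@sigma_algebraC (T : pointedType)).
  apply: (@measurable_exists_lt _ (g_sigma_algebraType (cylinders Z (prefix n)))).
  move=> k kn; apply: sub_smallest2r (sA k); first exact: smallest_sigma_algebra.
  move=> _ [J [B [JK mB ->]]]; exists J, B; split => // j /JK Kj.
  by exists k.
exact: (@sigma_algebraC (T : pointedType)).
Qed.

End independent_sums.

(** * Row maxima and their laws *)

Section exceedance.
Context {R : realType}.

(** A finite union in place of a level set of the maximum: measurability and monotonicity in [n] are
    immediate, and no default value of an empty maximum enters. [W] is arbitrary so that it can also
    be the space of sequences. *)
Definition exceed {W : Type} (a b : nat -> W -> R) (n : nat) (x : R) : set W :=
  [set w | exists2 i, (i < n)%N &
    exists2 j, (j < n)%N & (i != j) && (x <= `|a i w * b j w|)].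

Lemma measurable_exceed {d} {W : measurableType d} (a b : nat -> W -> R) n x :
  (forall i, measurable_fun setT (a i)) -> (forall i, measurable_fun setT (b i)) ->
  measurable (exceed a b n x).
Proof.
move=> ma mb; apply: measurable_exists_lt => i _; apply: measurable_exists_lt => j _.
case: (i == j) => /=.
  by rewrite [X in measurable X](_ : _ = set0)//; apply/seteqP; split.
by apply: measurable_ge; apply: measurableT_comp => //; exact: measurable_funM.
Qed.

Lemma exceed_mono {W : Type} (a b : nat -> W -> R) m n x y : (m <= n)%N -> y <= x ->
  exceed a b m x `<=` exceed a b n y.
Proof.
move=> mn yx w [i im [j jm /andP[ij xij]]]; exists i; first exact: leq_trans mn.
by exists j; [exact: leq_trans mn|rewrite ij (le_trans yx)].
Qed.

End exceedance.

(** * Equality of laws under injective reindexing *)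

Section reindexing.
Context {d d' : measure_display} {T : measurableType d} {S : measurableType d'}
  {R : realType} (P : probability T R).

Lemma mutually_independent_reindex {I J : choiceType} (Z : I -> T -> S) (phi : J -> I) :
  injective phi -> mutually_independent P Z -> mutually_independent P (fun j => Z (phi j)).
Proof.
move=> phi_inj iZ F A mA.
(* Transport of the sets along [phi] without an inverse: by injectivity [A' (phi j)] is [A j], and
   off the image of [F] the empty intersection is the whole space. *)
pose A' i := \bigcap_(j in [set j | j \in F /\ phi j = i]) A j.
have A'E j : j \in F -> A' (phi j) = A j.
  move=> jF; apply/seteqP; split => [s h|s As k [_ /phi_inj ->]//].
  exact: h.
have mA' i : measurable (A' i).
  apply: fin_bigcap_measurable => //.
  by apply: (sub_finite_set (B := [set` F])) => // j [].
have -> : \bigcap_(j in [set` F]) (Z (phi j) @^-1` A j) =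
    \bigcap_(i in [set` [fset phi j | j in F]%fset]) (Z i @^-1` A' i).
  apply/seteqP; split => t h.
    by move=> i /= /imfsetP[j /= jF ->]; rewrite A'E//; exact: h.
  move=> j /= jF; have := h (phi j); rewrite /= A'E//; apply.
  exact: in_imfset.
rewrite iZ// big_imfset/=; last by move=> i j _ _; exact: phi_inj.
by rewrite big_seq [RHS]big_seq; apply: eq_bigr => j jF; rewrite A'E.
Qed.

(** Both sequences push [P] to measures on the sequence space that agree on cylinders, by
    independence and equal marginals. Cylinders form a pi-system containing the whole space, so the
    two measures coincide. *)
Lemma eq_law_sequences (Z1 Z2 : nat -> T -> S) (B : set (nat -> S)) :
  (forall j, measurable_fun setT (Z1 j)) -> (forall j, measurable_fun setT (Z2 j)) ->
  mutually_independent P Z1 -> mutually_independent P Z2 ->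
  (forall j A, measurable A -> P (Z1 j @^-1` A) = P (Z2 j @^-1` A)) ->
  <<s cylinders (fun j (w : nat -> S) => w j) setT >> B ->
  P ((fun t j => Z1 j t) @^-1` B) = P ((fun t j => Z2 j t) @^-1` B).
Proof.
move=> mZ1 mZ2 iZ1 iZ2 Z12 sB.
pose G := cylinders (fun j (w : nat -> S) => w j) setT.
have mG (Z : nat -> T -> S) : (forall j, measurable_fun setT (Z j)) ->
    measurable_fun setT (fun t => (fun j => Z j t) : g_sigma_algebraType G).
  move=> mZ; apply: (@measurability _ _ T (g_sigma_algebraType G) setT _ G) => //.
  move=> _ [_ [J [A [_ mA ->]]] <-]; rewrite setTI preimage_bigcap.
  apply: fin_bigcap_measurable => // j _.
  by rewrite -[X in measurable X]setTI; exact: mZ.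
apply: (@measure_unique _ R (g_sigma_algebraType G) G (fun=> setT) _ _ _ _
  (pushforward P (fun t => (fun j => Z1 j t) : g_sigma_algebraType G))
  (pushforward P (fun t => (fun j => Z2 j t) : g_sigma_algebraType G))) => //.
- exact: cylinders_setI.
- by move=> _; exact: cylinders_setT.
- by rewrite bigcup_const//; exists 0%N.
- exact: mG.
- exact: mG.
- move=> m1 m2 _ [J [A [_ mA ->]]].
  transitivity (\prod_(j <- J) P (Z1 j @^-1` A j))%E; first exact: (iZ1 J A mA).
  transitivity (\prod_(j <- J) P (Z2 j @^-1` A j))%E; last exact/esym/(iZ2 J A mA).
  by apply: eq_bigr => j _; exact: Z12.
- move=> m1 _; apply: (@le_lt_trans _ _ 1%E); last exact: ltry.
  exact: (probability_le1 P measurableT).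
Qed.

Lemma eq_law_exceed (Z1 Z2 : nat -> T -> S) (u v : S -> R) n x :
  (forall j, measurable_fun setT (Z1 j)) -> (forall j, measurable_fun setT (Z2 j)) ->
  mutually_independent P Z1 -> mutually_independent P Z2 ->
  (forall j A, measurable A -> P (Z1 j @^-1` A) = P (Z2 j @^-1` A)) ->
  measurable_fun setT u -> measurable_fun setT v ->
  P (exceed (fun i t => u (Z1 i t)) (fun i t => v (Z1 i t)) n x) =
  P (exceed (fun i t => u (Z2 i t)) (fun i t => v (Z2 i t)) n x).
Proof.
move=> mZ1 mZ2 iZ1 iZ2 Z12 mu mv.
pose B : set (nat -> S) := exceed (fun i w => u (w i)) (fun i w => v (w i)) n x.
apply: (eq_law_sequences (B := B)) => //.
pose G := cylinders (fun j (w : nat -> S) => w j) setT.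
have cG i : measurable_fun setT (fun w : g_sigma_algebraType G => w i).
  exact: (generated_by_coordinate (Z := fun j (w : nat -> S) => w j)).
suff : measurable (B : set (g_sigma_algebraType G)) by [].
by apply: measurable_exceed => i; exact: measurableT_comp.
Qed.

End reindexing.

(** * Choices of cells in the array and comparison of row maxima of different lengths *)

Section array.
Context {d : measure_display} {T : measurableType d} {R : realType}
  (P : probability T R) (U V : nat -> nat -> {RV P >-> R}).
Hypothesis iidUV : iid_array P (fun k i => U k i) (fun k i => V k i).

Local Notation Z := (pairUV (fun k i => U k i : T -> R) (fun k i => V k i : T -> R)).

Lemma measurable_pairUV ki : measurable_fun setT (Z ki).
Proof. exact: measurable_fun_pair. Qed.

Lemma independent_pairUV : mutually_independent P Z.
Proof. exact: iidUV.2. Qed.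

Lemma generated_by_U (K : set (nat * nat)) k i : K (k, i) -> generated_by Z K (U k i).
Proof.
move=> Kki; exact: (@measurableT_comp _ _ _ (g_sigma_algebraType (cylinders Z K)) _ _
  fst setT (Z (k, i)) measurable_fst (generated_by_coordinate (Z := Z) Kki)).
Qed.

Lemma generated_by_V (K : set (nat * nat)) k i : K (k, i) -> generated_by Z K (V k i).
Proof.
move=> Kki; exact: (@measurableT_comp _ _ _ (g_sigma_algebraType (cylinders Z K)) _ _
  snd setT (Z (k, i)) measurable_snd (generated_by_coordinate (Z := Z) Kki)).
Qed.

Let rZ ki : {RV P >-> (R * R)%type} :=
  HB.pack (Z ki) (isMeasurableFun.Build _ _ _ _ _ (measurable_pairUV ki)).

Let eq_law ki lj A : measurable A -> distribution P (rZ ki) A = distribution P (rZ lj) A.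
Proof. by move=> mA; rewrite /distribution /pushforward iidUV.1// [in RHS]iidUV.1. Qed.

Lemma L1_identical (f : R * R -> R) (ki lj : nat * nat) : measurable_fun setT f ->
  L1 P (fun t => f (Z ki t)) -> L1 P (fun t => f (Z lj t)).
Proof.
move=> mf /integrableP[_ ifin]; apply/integrableP; split.
  by apply/measurable_EFinP; apply: measurableT_comp => //; exact: measurable_pairUV.
have eqI ij : (\int[P]_t `|(f (Z ij t))%:E| = \int[distribution P (rZ ij)]_z `|(f z)%:E|)%E.
  rewrite ge0_integral_distribution//.
  by apply: measurableT_comp => //; exact/measurable_EFinP.
rewrite /= eqI; rewrite /= eqI in ifin.
by rewrite (eq_measure_integral (distribution P (rZ ki)))// => A mA _; exact: eq_law.
Qed.

Lemma mean_identical (f : R * R -> R) (ki lj : nat * nat) : measurable_fun setT f ->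
  L1 P (fun t => f (Z ki t)) ->
  mean P (fun t => f (Z lj t)) = mean P (fun t => f (Z ki t)).
Proof.
move=> mf iki; have ilj := L1_identical lj mf iki.
have mfE : measurable_fun setT (EFin \o f) by exact/measurable_EFinP.
have eqI ij : L1 P (fun t => f (Z ij t)) ->
    (\int[P]_t (f (Z ij t))%:E = \int[distribution P (rZ ij)]_z (f z)%:E)%E.
  by move=> iij; rewrite integral_distribution.
rewrite /mean /Rintegral !eqI//; congr fine.
by apply: eq_measure_integral => A mA _; exact: eq_law.
Qed.

(** [phi] chooses the cells that play the role of the columns. For injective [phi] the probability
    does not depend on the choice, which covers other rows as well as blocks of columns. *)
Definition exceed_at (phi : nat -> nat * nat) n x : set T :=
  exceed (fun i => U (phi i).1 (phi i).2 : T -> R) (fun i => V (phi i).1 (phi i).2 : T -> R) n x.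

Lemma measurable_exceed_at phi n x : measurable (exceed_at phi n x).
Proof. exact: measurable_exceed. Qed.

Lemma prob_exceed_at (phi psi : nat -> nat * nat) n x :
  injective phi -> injective psi ->
  prob P (exceed_at phi n x) = prob P (exceed_at psi n x).
Proof.
move=> phi_inj psi_inj; rewrite /prob; congr fine.
apply: (eq_law_exceed (Z1 := Z \o phi) (Z2 := Z \o psi) (u := fst) (v := snd)).
- by move=> j; exact: measurable_pairUV.
- by move=> j; exact: measurable_pairUV.
- exact: mutually_independent_reindex phi_inj independent_pairUV.
- exact: mutually_independent_reindex psi_inj independent_pairUV.
- by move=> j A mA /=; rewrite iidUV.1// [in RHS]iidUV.1.
- exact: measurable_fst.
- exact: measurable_snd.
Qed.

Definition row (k i : nat) : nat * nat := (k, i).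

Lemma row_inj k : injective (row k).
Proof. by move=> i j []. Qed.

(* Two blocks of [m] columns among [K] carry the same law as the first [2 m] columns. *)
Lemma prob_exceed_blocks (K m : nat) x : (1 < K)%N ->
  prob P (exceed_at (row 0) (K * m) x) <=
  (K ^ 2)%:R * prob P (exceed_at (row 0) (2 * m) x).
Proof.
move=> K1.
(* The first [m] indices go to block [a] and the next [m] to block [b]. The remaining indices are
   sent to row 1 only to make the map injective on all of [nat]. *)
pose phi a b i := if (i < m)%N then (0, a * m + i)%N
  else if (i < 2 * m)%N then (0, b * m + (i - m))%N else (1, i)%N.
have phi_inj a b : a != b -> injective (phi a b).
  move=> ab i j; rewrite /phi.
  have neq k l : (k < m)%N -> (l < m)%N -> (a * m + k != b * m + l)%N.
    move=> km lm; apply/eqP => e; move/eqP: ab; apply.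
    have m0 : (0 < m)%N by exact: leq_ltn_trans km.
    by have := congr1 (divn^~ m) e; rewrite /= !divnMDl// !divn_small// !addn0.
  have [im|im] := ltnP i m; have [jm|jm] := ltnP j m.
  - by case; lia.
  - have [jm2|jm2] := ltnP j (2 * m)%N => -[] // e.
    have jm3 : (j - m < m)%N by lia.
    by have := neq i (j - m)%N im jm3; rewrite e eqxx.
  - have [im2|im2] := ltnP i (2 * m)%N => -[] // e.
    have im3 : (i - m < m)%N by lia.
    by have := neq j (i - m)%N jm im3; rewrite e eqxx.
  - by have [im2|im2] := ltnP i (2 * m)%N; have [jm2|jm2] := ltnP j (2 * m)%N => -[] //; lia.
(* If both columns lie in the same block, the second slot is filled by a different block to preserve
   injectivity. *)
pose other a := if a == 0%N then 1%N else 0%N.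
pose psi a b := phi a (if a == b then other a else b).
have psi_inj a b : injective (psi a b).
  by apply: phi_inj; case: ifPn => // _; rewrite /other; case: a.
pose F a b := exceed_at (psi a b) (2 * m) x.
have mF a b : measurable (F a b) by exact: measurable_exceed_at.
have PF a b : prob P (F a b) <= prob P (exceed_at (row 0) (2 * m) x).
  by rewrite (prob_exceed_at _ _ (@psi_inj a b) (@row_inj 0)).
have H1 a := prob_exists_lt_le (n := K) (fun b _ => mF a b) (fun b _ => PF a b).
have mH1 a : measurable [set t | exists2 b, (b < K)%N & F a b t].
  by apply: measurable_exists_lt.
have H2 := prob_exists_lt_le (n := K) (fun a _ => mH1 a) (fun a _ => H1 a).
rewrite expnS expn1 natrM -mulrA; apply: le_trans H2.
apply: prob_le; [exact: measurable_exceed_at|exact: measurable_exists_lt|].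
move=> t [i iKm [j jKm /andP[ij xij]]].
have m0 : (0 < m)%N by rewrite lt0n; apply/eqP => m0; rewrite m0 muln0 in iKm.
exists (i %/ m)%N; first by rewrite ltn_divLR.
exists (j %/ m)%N; first by rewrite ltn_divLR.
have im := ltn_pmod i m0; have jm := ltn_pmod j m0.
exists (i %% m)%N; first lia.
rewrite /row /= in xij.
have E1 b : phi (i %/ m)%N b (i %% m)%N = (0, i)%N by rewrite /phi im -divn_eq.
have [e|ne] := eqVneq (i %/ m)%N (j %/ m)%N.
  exists (j %% m)%N; first lia.
  rewrite /psi E1 e /phi jm -divn_eq /= xij andbT.
  by apply: contra ij => /eqP e'; rewrite (divn_eq i m) e e' -divn_eq.
exists (m + j %% m)%N; first lia.
rewrite /psi E1 (negPf ne) /phi ltnNge leq_addr /= ifT; last lia.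
rewrite addKn -divn_eq xij andbT.
lia.
Qed.

Lemma prob_exceed_pow2 (l r : nat) x : (0 < l)%N ->
  prob P (exceed_at (row 0) (2 ^ (l + r)) x) <=
  (4 ^ r.+1)%:R * prob P (exceed_at (row 0) (2 ^ l) x).
Proof.
(* With the new [l] one less than the old, blocks of 2^l columns come in pairs of 2^(l+1), and the
   2^(r+1) blocks cover all columns; squaring their number gives 4^(r+1). *)
case: l => // l _; have := @prob_exceed_blocks (2 ^ r.+1) (2 ^ l) x.
rewrite -expnD -expnS -expnM [(r.+1 * 2)%N]mulnC expnM addSnnS addnC.
by apply; rewrite -[1%N]/(2 ^ 0)%N ltn_exp2l.
Qed.

End array.

(** * Bounded partial sums and Borel-Cantelli *)

Section bounded_sums.
Context {R : realType}.
Implicit Types u v w : nat -> R.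

Lemma sum_nat_shift {V : nmodType} (u : nat -> V) m n :
  \sum_(m <= k < n) u k = \sum_(0 <= k < n - m) u (m + k)%N.
Proof.
rewrite -[X in \sum_(X <= _ < _) _]add0n big_addn.
by apply: eq_bigr => k _; rewrite addnC.
Qed.

Definition bounded_sums u := exists B, forall n, \sum_(0 <= k < n) u k <= B.

Lemma bounded_sums_le (C : R) (N : nat) u v : 0 <= C -> (forall k, 0 <= v k) ->
  (forall k, (N <= k)%N -> u k <= C * v k) -> bounded_sums v -> bounded_sums u.
Proof.
move=> C0 v0 uv [B hB]; exists (\sum_(0 <= k < N) `|u k| + C * B) => n.
have vB m : \sum_(m <= k < n) u k <= \sum_(m <= k < n) `|u k|.
  by apply: ler_sum => k _; exact: ler_norm.
have B0 : 0 <= C * B by rewrite mulr_ge0// (le_trans _ (hB 0%N))// big_geq.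
have [nN|Nn] := leqP n N.
  rewrite (le_trans (vB 0%N))// (big_cat_nat (leq0n n) nN)/= -addrA lerDl.
  by rewrite addr_ge0// sumr_ge0.
rewrite (big_cat_nat (leq0n N) (ltnW Nn))/= lerD//.
  by apply: ler_sum => k _; exact: ler_norm.
apply: (@le_trans _ _ (\sum_(N <= k < n) C * v k)).
  by rewrite big_nat_cond [leRHS]big_nat_cond; apply: ler_sum => k /andP[/andP[Nk _] _]; exact: uv.
rewrite -mulr_sumr ler_wpM2l// (le_trans _ (hB n))//.
by rewrite [leRHS](big_cat_nat (leq0n N) (ltnW Nn))/= lerDr sumr_ge0.
Qed.

Lemma bounded_sums_shift u N : bounded_sums (fun k => u (N + k)%N) -> bounded_sums u.
Proof.
move=> [B hB]; exists (\sum_(0 <= k < N) `|u k| + `|B|) => n.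
have [nN|Nn] := leqP n N.
  apply: (@le_trans _ _ (\sum_(0 <= k < n) `|u k|)).
    by apply: ler_sum => k _; exact: ler_norm.
  by rewrite (big_cat_nat (leq0n n) nN)/= -addrA lerDl addr_ge0// sumr_ge0.
rewrite (big_cat_nat (leq0n N) (ltnW Nn))/= lerD//.
  by apply: ler_sum => k _; exact: ler_norm.
rewrite (le_trans _ (ler_norm B))// (le_trans _ (hB (n - N)%N))//.
by rewrite [leLHS]sum_nat_shift.
Qed.

Lemma bounded_sums_unshift u N : (forall k, 0 <= u k) -> bounded_sums u ->
  bounded_sums (fun k => u (N + k)%N).
Proof.
move=> u0 [B hB]; exists B => n; apply: le_trans (hB (N + n)%N).
rewrite (big_cat_nat (leq0n N) (leq_addr n N))/= [X in _ + X]sum_nat_shift addKn.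
by rewrite lerDr sumr_ge0.
Qed.

Lemma bounded_sums_geometric (q : R) : 0 <= q -> q < 1 -> bounded_sums (fun k => q ^+ k).
Proof.
move=> q0 q1; exists (1 - q)^-1 => n.
have q1' : 0 < 1 - q by rewrite subr_gt0.
have E : (1 - q) * \sum_(0 <= k < n) q ^+ k = 1 - q ^+ n.
  elim: n => [|n IH]; first by rewrite big_geq// mulr0 expr0 subrr.
  by rewrite big_nat_recr//= mulrDr IH exprS; ring.
rewrite -(ler_pM2l q1') E divff ?lt0r_neq0//.
by rewrite lerBlDr lerDl exprn_ge0.
Qed.

Let sum_dyadic u K :
  \sum_(1 <= n < 2 ^ K) u n = \sum_(0 <= k < K) \sum_(2 ^ k <= n < 2 ^ k.+1) u n.
Proof.
elim: K => [|K IH]; first by rewrite !big_geq.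
rewrite [RHS]big_nat_recr//= -IH -(big_cat_nat) //=; first by rewrite expn_gt0.
by rewrite leq_exp2l.
Qed.

(** Cauchy condensation without monotone terms: in P(M_n >= nrm n) both the maximum and the
    threshold grow with n, so a bound [w k] valid on the whole dyadic block replaces
    monotonicity. *)
Lemma bounded_sums_condense u w : (forall n, 0 <= u n) ->
  (forall k n, (2 ^ k <= n < 2 ^ k.+1)%N -> w k <= u n) ->
  bounded_sums u -> bounded_sums (fun k => (2 ^ k)%:R * w k).
Proof.
move=> u0 wu [B hB]; exists B => K; apply: le_trans (hB (2 ^ K)%N).
have K0 : (1 <= 2 ^ K)%N by rewrite expn_gt0.
rewrite (big_cat_nat (leq0n 1) K0)/= sum_dyadic.
apply: ler_wpDl; first by rewrite sumr_ge0.
apply: ler_sum => k _.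
rewrite (_ : (2 ^ k)%:R * w k = \sum_(2 ^ k <= n < 2 ^ k.+1) w k).
  by rewrite big_nat_cond [leRHS]big_nat_cond; apply: ler_sum => n /andP[h _]; exact: wu.
by rewrite sumr_const_nat expnS mul2n -addnn addnK mulr_natl.
Qed.

Lemma bounded_sums_uncondense u w : (forall n, 0 <= u n) ->
  (forall k n, (2 ^ k <= n < 2 ^ k.+1)%N -> u n <= w k) ->
  bounded_sums (fun k => (2 ^ k)%:R * w k) -> bounded_sums u.
Proof.
move=> u0 uw [B hB]; exists (u 0%N + B) => K.
apply: (@le_trans _ _ (\sum_(0 <= n < 2 ^ K) u n)).
  rewrite [leRHS](big_cat_nat (leq0n K) (ltnW (ltn_expl K (ltnSn 1))))/=.
  by rewrite lerDl sumr_ge0.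
have K0 : (1 <= 2 ^ K)%N by rewrite expn_gt0.
rewrite (big_cat_nat (leq0n 1) K0)/= big_nat1 lerD2l sum_dyadic.
apply: le_trans (hB K).
apply: ler_sum => k _.
rewrite (_ : (2 ^ k)%:R * w k = \sum_(2 ^ k <= n < 2 ^ k.+1) w k).
  by rewrite big_nat_cond [leRHS]big_nat_cond; apply: ler_sum => n /andP[h _]; exact: uw.
by rewrite sumr_const_nat expnS mul2n -addnn addnK mulr_natl.
Qed.

End bounded_sums.

Section borel_cantelli.
Context {d : measure_display} {T : measurableType d} {R : realType} (P : probability T R).

Lemma bounded_sums_nneseries (A : nat -> set T) m : (forall n, measurable (A n)) ->
  (\sum_(m <= n <oo) P (A n) < +oo)%E <-> bounded_sums (fun k => prob P (A (m + k)%N)).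
Proof.
move=> mA.
have E n : (\sum_(m <= k < m + n) P (A k))%E =
    (\sum_(0 <= k < n) prob P (A (m + k)%N))%:E.
  rewrite -sumEFin sum_nat_shift addKn; apply: eq_bigr => k _.
  by rewrite probE.
split => [h|[B hB]].
  exists (fine (\sum_(m <= n <oo) P (A n))) => n.
  rewrite -lee_fin fineK; last first.
    by rewrite ge0_fin_numE// nneseries_ge0.
  by rewrite -E; apply: nneseries_lim_ge.
apply: (@le_lt_trans _ _ B%:E); last exact: ltry.
apply: lime_le; first exact: is_cvg_nneseries.
exists m => // n /= mn; rewrite -(subnKC mn).
by rewrite E lee_fin.
Qed.

Lemma borel_cantelli (A : nat -> set T) : (forall n, measurable (A n)) ->
  bounded_sums (fun k => prob P (A k)) ->
  {ae P, forall t, exists N, forall n, (N <= n)%N -> ~ A n t}.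
Proof.
move=> mA hA.
have h0 : P (lim_sup_set A) = 0%E.
  by apply: lim_sup_set_cvg0 => //; apply/(bounded_sums_nneseries 0).
exists (lim_sup_set A); split => //.
  by apply: bigcapT_measurable => n; apply: bigcup_measurable.
move=> t h n _; apply: contrapT => h2; apply: h; exists n => k nk Ak.
by apply: h2; exists k.
Qed.

End borel_cantelli.

(** * Growth of the normalization and cube moments *)

Section nrm_facts.
Context {R : realType}.

Lemma nat_gt (x : R) : exists n : nat, x < n%:R.
Proof. by exists (Num.bound `|x|); exact: le_lt_trans (ler_norm _) (archi_boundP (normr_ge0 x)). Qed.

Lemma ln_nat_ge0 (n : nat) : 0 <= ln n%:R :> R.
Proof. by case: n => [|n]; [rewrite ln0|rewrite ln_ge0// ler1n]. Qed.

Lemma nrm_ge0 n : 0 <= nrm n :> R.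
Proof. exact: sqrtr_ge0. Qed.

Lemma nrm_sq n : nrm n ^+ 2 = n%:R * ln n%:R :> R.
Proof. by rewrite sqr_sqrtr// mulr_ge0// ln_nat_ge0. Qed.

Lemma nrm_gt0 n : (1 < n)%N -> 0 < nrm n :> R.
Proof.
move=> n1; rewrite sqrtr_gt0 mulr_gt0// ?ltr0n ?(ltn_trans _ n1)//.
by rewrite ln_gt0// ltr1n.
Qed.

Lemma le_nrm m n : (m <= n)%N -> nrm m <= nrm n :> R.
Proof.
case: m => [_|m mn]; first by rewrite {1}/nrm mul0r sqrtr0 nrm_ge0.
rewrite ler_wsqrtr// ler_pM// ?ln_nat_ge0 ?ler_nat//.
by rewrite ler_ln ?posrE ?ltr0n ?ler_nat// (leq_trans _ mn).
Qed.

(** A shift by [s] multiplies [nrm] by at least 2^(s/2), since the logarithm only grows. Constant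
    factors in thresholds can thus be traded for dyadic shifts. *)
Lemma nrm_pow2_scale (eta : R) k s : 0 <= eta -> 1 <= eta ^+ 2 * (2 ^ s)%:R ->
  nrm (2 ^ k) <= eta * nrm (2 ^ (k + s)).
Proof.
move=> eta0 h; rewrite -ler_sqr ?nnegrE ?mulr_ge0 ?nrm_ge0// exprMn !nrm_sq.
have -> : eta ^+ 2 * ((2 ^ (k + s))%:R * ln (2 ^ (k + s))%:R) =
    (2 ^ k)%:R * (eta ^+ 2 * (2 ^ s)%:R * ln (2 ^ (k + s))%:R).
  by rewrite expnD natrM; ring.
rewrite ler_wpM2l//.
have l1 : ln (2 ^ k)%:R <= ln (2 ^ (k + s))%:R :> R.
  by rewrite ler_ln ?posrE ?ltr0n ?expn_gt0// ler_nat leq_exp2l// leq_addr.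
by rewrite (le_trans l1)// ler_peMl// ln_nat_ge0.
Qed.

Lemma nrm_pow2_sq_le k : nrm (2 ^ k) ^+ 2 <= (2 ^ k)%:R * k%:R :> R.
Proof.
rewrite nrm_sq ler_wpM2l// natrX lnXn// -[leRHS]mulr1 mulr_natl ler_wMn2r//.
by have := @le_ln1Dx R 1 ltac:(lra); rewrite -natr1.
Qed.

Lemma pow2_gt (x : R) : exists s, x < (2 ^ s)%:R.
Proof.
have [n xn] := nat_gt x; exists n; rewrite (lt_trans xn)// ltr_nat.
exact: ltn_expl.
Qed.

Lemma linear_lt_pow2 (C : R) : exists i0, forall i, (i0 <= i)%N -> C * i%:R <= (2 ^ i)%:R.
Proof.
have [s Cs] := pow2_gt C; exists (4 + s.*2)%N => i i0.
apply: (@le_trans _ _ ((2 ^ s)%:R * i%:R)); first by rewrite ler_wpM2r// ltW.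
rewrite -natrM ler_nat -(subnKC (_ : (s <= i)%N)); last lia.
rewrite expnD leq_mul2l (subnKC (_ : (s <= i)%N)); last lia.
apply/orP; right.
(* Each half of the exponent contributes a linear factor, so the power dominates a quadratic in
   [i]. *)
have -> : (i - s = (i - s)./2 + (i - s - (i - s)./2))%N by lia.
rewrite expnD.
have h1 := ltn_expl (i - s)./2 (ltnSn 1).
have h2 := ltn_expl (i - s - (i - s)./2) (ltnSn 1).
apply: (@leq_trans ((i - s)./2.+1 * (i - s - (i - s)./2).+1)); last exact: leq_mul.
nia.
Qed.

End nrm_facts.

Section cube_moment.
Context {d : measure_display} {T : measurableType d} {R : realType} (P : probability T R).

(** On the layer from 16^i to 16^(i+1) the cube is at most 16^(3 (i+1)) = 2^(12 (i+1)), and the tail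
    2^-(14 i) leaves a geometric series of ratio 1/4. *)
Lemma L1_cube_of_tail (f : T -> R) (C : R) (i0 : nat) : measurable_fun setT f ->
  (forall t, 0 <= f t) ->
  (forall i, (i0 <= i)%N ->
    prob P [set t | 16 ^+ i <= f t] <= C * 2^-1 ^+ (14 * i)) ->
  L1 P (fun t => f t ^+ 3).
Proof.
move=> mf f0 tail.
pose A i := [set t | (16 : R) ^+ i <= f t].
have mA i : measurable (A i) by exact: measurable_ge.
pose c i : R := (16 ^+ i.+1) ^+ 3.
have c0 i : 0 <= c i by rewrite !exprn_ge0.
pose g i t : \bar R := (c (i0 + i)%N * \1_(A (i0 + i)%N) t)%:E.
have g0 i t : (0 <= g i t)%E by rewrite lee_fin mulr_ge0.
have mg i : measurable_fun setT (g i).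
  by apply/measurable_EFinP; apply: measurable_funM => //; exact: measurable_indic.
have mf3 : measurable_fun setT (fun t => f t ^+ 3) by exact: measurable_funX.
apply/integrableP; split; first exact/measurable_EFinP.
have pointwise t : (`|(f t ^+ 3)%:E| <= (c i0)%:E + \sum_(0 <= i <oo) g i t)%E.
  rewrite /= ger0_norm ?exprn_ge0//.
  have S0 : (0 <= \sum_(0 <= i <oo) g i t)%E by exact: nneseries_ge0.
  have ex : exists i, f t < 16 ^+ i.+1.
    have [n fn] := nat_gt (f t); exists n; rewrite (lt_trans fn)// -natrX ltr_nat.
    by rewrite (ltn_trans (ltnSn n))// ltn_expl.
  have f3 i : f t < 16 ^+ i.+1 -> f t ^+ 3 <= c i.
    by move=> fi; rewrite ler_pXn2r// ?nnegrE ?exprn_ge0// ltW.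
  (* The layer containing [f t]: by minimality [f t >= 16 ^+ i] when [i > i0], so term [i - i0] of
     the series pays for it; otherwise the constant [c i0] does. *)
  case: (ex_minnP ex) => i fi mini.
  have [ii0|i0i] := leqP i i0.
    apply: (@le_trans _ _ (c i0)%:E); last by rewrite leeDl.
    rewrite lee_fin; apply: f3; rewrite (lt_le_trans fi)//.
    by rewrite ler_eXn2l// ltr1n.
  apply: (@le_trans _ _ (\sum_(0 <= i <oo) g i t)%E); last first.
    by rewrite leeDr// lee_fin.
  apply: (@le_trans _ _ (\sum_(0 <= j < (i - i0).+1) g j t)%E).
    have At : A i t.
      rewrite /A /= leNgt; apply/negP => h.
      have i1 : i.-1.+1 = i by rewrite prednK// (leq_ltn_trans _ i0i).
      by have := mini i.-1; rewrite i1 => /(_ h); rewrite -ltnS i1 ltnn.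
    have E : g (i - i0)%N t = (c i)%:E.
      by rewrite /g (subnKC (ltnW i0i)) indicE mem_set// mulr1.
    rewrite big_nat_recr//= E.
    apply: (@le_trans _ _ (c i)%:E); first by rewrite lee_fin; exact: f3.
    by rewrite leeDr// sume_ge0.
  exact: nneseries_lim_ge.
apply: (@le_lt_trans _ _ (\int[P]_t ((c i0)%:E + \sum_(0 <= i <oo) g i t))%E).
  apply: ge0_le_integral => //.
  - by apply: measurableT_comp => //; exact/measurable_EFinP.
  - by apply: emeasurable_funD => //; exact: ge0_emeasurable_sum.
  - by move=> t _; exact: pointwise.
rewrite ge0_integralD//; last 3 first.
- by move=> t _; rewrite lee_fin.
- by move=> t _; exact: nneseries_ge0.
- exact: ge0_emeasurable_sum.
rewrite integral_cst// integral_nneseries//.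
apply: lte_add_pinfty.
  by rewrite lte_mul_pinfty ?lee_fin// (le_lt_trans (probability_le1 P _))// ltry.
have Eg i : (\int[P]_t g i t = (c (i0 + i)%N * prob P (A (i0 + i)%N))%:E)%E.
  rewrite /g; under eq_integral do rewrite EFinM.
  rewrite ge0_integralZl_EFin//; last by apply/measurable_EFinP; exact: measurable_indic.
  rewrite integral_indic// setIT [RHS]EFinM; congr (_ * _)%E; exact: probE.
under eq_eseriesr do rewrite Eg.
have bs : bounded_sums (fun i => c (i0 + i)%N * prob P (A (i0 + i)%N)).
  apply: (bounded_sums_le (C := `|C| * 16 ^+ 3) (N := 0) (v := fun i => (4^-1) ^+ i)).
  - by rewrite mulr_ge0// exprn_ge0.
  - by move=> i; rewrite exprn_ge0.
  - move=> i _.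
    set m := (i0 + i)%N.
    apply: (@le_trans _ _ (c m * (`|C| * 2^-1 ^+ (14 * m)))).
      rewrite ler_wpM2l// (le_trans (tail _ (leq_addr _ _)))// ler_wpM2r ?exprn_ge0//.
      exact: ler_norm.
    have E : c m * (`|C| * 2^-1 ^+ (14 * m)) = `|C| * 16 ^+ 3 * (4^-1) ^+ m.
      have q : 4^-1 = 16 ^+ 3 * 2^-1 ^+ 14 :> R by field.
      rewrite /c [16 ^+ m.+1]exprS exprMn (exprM _ 14 m) q [(16 ^+ 3 * _) ^+ m]exprMn.
      rewrite [(16 ^+ 3) ^+ m]exprAC.
      by move: (16 ^+ m) ((2^-1 ^+ 14) ^+ m) => u v; ring.
    rewrite E ler_wpM2l ?mulr_ge0 ?exprn_ge0// exprD ler_piMl ?exprn_ge0//.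
    by apply: exprn_ile1; lra.
  - by apply: bounded_sums_geometric; lra.
have [B hB] := bs.
apply: (@le_lt_trans _ _ B%:E); last exact: ltry.
apply: lime_le.
  by apply: is_cvg_nneseries => i _ _; rewrite lee_fin mulr_ge0// prob_ge0.
by apply: nearW => n; rewrite sumEFin lee_fin.
Qed.

Lemma ae_zero_or_tail (f : T -> R) : measurable_fun setT f ->
  {ae P, forall t, f t = 0} \/ exists2 a, 0 < a & 0 < prob P [set t | a <= `|f t|].
Proof.
move=> mf; have [[a a0 pa]|h] := pselect (exists2 a, 0 < a & 0 < prob P [set t | a <= `|f t|]).
  by right; exists a.
left.
have mA n : measurable [set t | n.+1%:R^-1 <= `|f t|].
  by apply: measurable_ge; exact: measurableT_comp.
have h0 n : {ae P, forall t, `|f t| < n.+1%:R^-1}.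
  exists [set t | n.+1%:R^-1 <= `|f t|]; split => //.
    rewrite probE//; congr EFin; apply/eqP; rewrite eq_le prob_ge0 andbT leNgt.
    by apply/negP => pn; apply: h; exists n.+1%:R^-1.
  by move=> t /=; rewrite leNgt => /negP.
have := ae_foralln h0; apply: filterS => t ht.
apply/eqP; rewrite -normr_eq0 eq_le normr_ge0 andbT leNgt; apply/negP => ft.
have [n fn] := nat_gt (`|f t|^-1).
have : `|f t| < n.+1%:R^-1 := ht n.
rewrite ltNge => /negP; apply.
rewrite -[leRHS]invrK lef_pV2 ?posrE ?invr_gt0// (le_trans (ltW fn))// ler_nat.
exact: leqnSn.
Qed.

End cube_moment.

(** * The dyadic form of the summability condition *)

Section row_maximum.
Context {d : measure_display} {T : measurableType d} {R : realType}
  (P : probability T R) (U V : nat -> nat -> {RV P >-> R}).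
Hypothesis iidUV : iid_array P (fun k i => U k i) (fun k i => V k i).

Local Notation Z := (pairUV (fun k i => U k i : T -> R) (fun k i => V k i : T -> R)).
Local Notation M := (Mn (fun k i => U k i : T -> R) (fun k i => V k i : T -> R)).
Local Notation pe n x := (prob P (exceed_at U V (row 0) n x)).

Lemma exceed_sub_Mn n x : exceed_at U V (row 0) n x `<=` [set t | x <= M n t].
Proof.
move=> t [i im [j jm /andP[ij xij]]] /=.
by apply/bigmax_geP; right; exists (Ordinal im) => //; apply/bigmax_geP; right; exists (Ordinal jm).
Qed.

(** Positivity of [x] excludes the default value 0 of the maximum. *)
Lemma Mn_exceedE n x : 0 < x -> [set t | x <= M n t] = exceed_at U V (row 0) n x.
Proof.
move=> x0; apply/seteqP; split; last exact: exceed_sub_Mn.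
move=> t /= /bigmax_geP[|[i _ /bigmax_geP[|[j ij xij]]]].
- by rewrite leNgt x0.
- by rewrite leNgt x0.
- by exists i => //; exists j => //; apply/andP.
Qed.

Lemma measurable_Mn_ge n x : measurable [set t | x <= M n t].
Proof.
have [x0|x0] := ltP 0 x; first by rewrite Mn_exceedE//; exact: measurable_exceed_at.
rewrite [X in measurable X](_ : _ = setT)//; apply/seteqP; split => // t _ /=.
by rewrite (le_trans x0)//; exact: bigmax_ge_id.
Qed.

Lemma dyadic_of_series :
  (\sum_(1 <= n <oo) P [set t | (nrm n <= M n t)%R] < +oo)%E ->
  bounded_sums (fun k => (2 ^ k)%:R * pe (2 ^ k) (nrm (2 ^ (k + 1)))).
Proof.
move=> /bounded_sums_nneseries-/(_ (fun n => measurable_Mn_ge n (nrm n))) h.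
have := @bounded_sums_shift _ (fun n => prob P [set t | nrm n <= M n t]) _ h.
apply: bounded_sums_condense => [n|k n /andP[kn nk]]; first exact: prob_ge0.
apply: prob_le; [exact: measurable_exceed_at|exact: measurable_Mn_ge|].
apply: subset_trans (@exceed_sub_Mn n (nrm n)).
by apply: exceed_mono => //; apply: le_nrm; rewrite addn1 ltnW.
Qed.

Section dyadic.
Variable s : nat.
Hypothesis dyadic : bounded_sums (fun k => (2 ^ k)%:R * pe (2 ^ k) (nrm (2 ^ (k + s)))).

(** The threshold is kept and the number of columns is changed: at index k = s + l the block bound
    passes from 2^(l+s+r) columns to 2^l at the constant cost 4^(s+r+1), and nrm(2^(l+s)) is the
    threshold of the hypothesis. *)
Lemma dyadic_transfer r : bounded_sums (fun k => (2 ^ k)%:R * pe (2 ^ (k + r)) (nrm (2 ^ k))).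
Proof.
apply: (@bounded_sums_shift _ _ s).
apply: (bounded_sums_le (C := (2 ^ s)%:R * (4 ^ (s + r).+1)%:R) (N := 1) _ _ _ dyadic).
- by rewrite mulr_ge0.
- by move=> k; rewrite mulr_ge0// prob_ge0.
- move=> l l0; rewrite (_ : (2 ^ (s + l))%:R = (2 ^ l)%:R * (2 ^ s)%:R); last first.
    by rewrite -natrM -expnD addnC.
  rewrite (addnC s l) -(addnA l s r).
  have := prob_exceed_pow2 iidUV (s + r) (nrm (2 ^ (l + s))) l0.
  set q := prob P _; set q' := prob P _ => qq.
  have -> : (2 ^ s)%:R * (4 ^ (s + r).+1)%:R * ((2 ^ l)%:R * q') =
    (2 ^ l)%:R * (2 ^ s)%:R * ((4 ^ (s + r).+1)%:R * q') by ring.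
  by rewrite ler_wpM2l// mulr_ge0.
Qed.

Lemma series_of_dyadic : (\sum_(1 <= n <oo) P [set t | (nrm n <= M n t)%R] < +oo)%E.
Proof.
apply/bounded_sums_nneseries; first by move=> n; exact: measurable_Mn_ge.
apply: (@bounded_sums_unshift _ (fun n => prob P [set t | nrm n <= M n t])).
  by move=> n; exact: prob_ge0.
(* The comparison starts at 2 because [nrm] vanishes at 0 and 1, where the maximum always reaches
   the threshold. *)
apply: (bounded_sums_le (C := 1) (N := 2) (v := fun n => pe n (nrm n))) => //.
- by move=> n; exact: prob_ge0.
- by move=> n n2; rewrite mul1r Mn_exceedE// nrm_gt0.
apply: bounded_sums_uncondense (dyadic_transfer 1) => [n|k n /andP[kn nk]].
  exact: prob_ge0.
apply: prob_le; [exact: measurable_exceed_at..|].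
by apply: exceed_mono; [rewrite addn1 ltnW|exact: le_nrm].
Qed.

(** A large U among the first [m] columns and a large V in column [m] are independent events that
    together force an exceedance. The first has probability 1 - (1-q)^m >= m q / (1 + m q), because
    (1 + m q) (1-q)^m <= 1. *)
Lemma max_tail_bound m (y a : R) : 0 <= y -> 0 <= a ->
  prob P [set t | a <= `|V 0 0 t|] * (m%:R * prob P [set t | y <= `|U 0 0 t|]) <=
  pe m.+1 (y * a) * (1 + m%:R * prob P [set t | y <= `|U 0 0 t|]).
Proof.
move=> y0 a0; set p := prob P [set t | a <= _]; set q := prob P [set t | y <= _].
have mZ := measurable_pairUV U V.
have iZ := independent_pairUV iidUV.
have mge (c : R) : measurable [set x : R | c <= `|x|].
  by apply: measurable_ge; exact: normr_measurable.
pose A k := [set t | y <= `|U 0 k t|].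
pose K k : set (nat * nat) := [set (0, k)%N].
have dK k l : k != l -> K k `&` K l = set0.
  by move=> kl; apply/seteqP; split => // i [/= -> [e]]; move: kl; rewrite e eqxx.
have sA k : <<s cylinders Z (K k) >> (A k).
  apply: (generated_byP (X := U 0 k) (B := [set x | y <= `|x|])) => //.
  exact: generated_by_U.
have mA k : measurable (A k) by exact: sigma_cylinders_measurable (sA k).
have PA k : prob P (A k) = q.
  rewrite /prob; congr fine.
  have mB : measurable [set z : R * R | y <= `|z.1|].
    by apply: measurable_ge; apply: measurableT_comp => //; exact: measurable_fst.
  exact: (iidUV.1 (0, k)%N _ mB).
pose D := [set t | a <= `|V 0 m t|].
have sD : <<s cylinders Z (K m) >> D.
  apply: (generated_byP (X := V 0 m) (B := [set x | a <= `|x|])) => //.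
  exact: generated_by_V.
have mD : measurable D by exact: sigma_cylinders_measurable sD.
have PD : prob P D = p.
  rewrite /prob; congr fine.
  have mB : measurable [set z : R * R | a <= `|z.2|].
    by apply: measurable_ge; apply: measurableT_comp => //; exact: measurable_snd.
  exact: (iidUV.1 (0, m)%N _ mB).
pose E := [set t | exists2 k, (k < m)%N & A k t].
have mE : measurable E by exact: measurable_exists_lt.
have PE : prob P E = 1 - (1 - q) ^+ m.
  have := prob_no_event mZ iZ dK m sA; rewrite prob_setC// big_mkord.
  by rewrite (eq_bigr (fun=> 1 - q)) => [|k _]; [rewrite prodr_const card_ord; lra|rewrite PA].
pose L : set (nat * nat) := [set i | exists2 k, (k < m)%N & K k i].
have sE : <<s cylinders Z L >> E.
  apply: (@measurable_exists_lt _ (g_sigma_algebraType (cylinders Z L))) => k km.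
  suff : <<s cylinders Z L >> (A k) by [].
  apply: (generated_byP (X := U 0 k) (B := [set x | y <= `|x|])) => //.
  by apply: generated_by_U; exists k.
have LK : L `&` K m = set0.
  apply/seteqP; split => // i [[k km ki] mi].
  by have : (K k `&` K m) i by []; rewrite dK// ltn_eqF.
have PED : prob P (E `&` D) = prob P E * prob P D.
  apply: EFin_inj; rewrite EFinM -!probE//; last exact: measurableI.
  exact: (sigma_cylinders_independent mZ iZ LK).
have sub : prob P (E `&` D) <= pe m.+1 (y * a).
  apply: prob_le; [exact: measurableI|exact: measurable_exceed_at|].
  move=> t [[k km Ak] Dt]; exists k; first exact: leqW.
  exists m => //; rewrite (ltn_eqF km) /= normrM.
  exact: ler_pM.
have q0 : 0 <= q by exact: prob_ge0.
have q1 : q <= 1 by rewrite -(PA 0%N) prob_le1.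
have p0 : 0 <= p by exact: prob_ge0.
have bern n : (1 + n%:R * q) * (1 - q) ^+ n <= 1.
  elim: n => [|n IH]; first by rewrite mul0r addr0 expr0 mulr1.
  apply: le_trans IH; rewrite exprS mulrA ler_wpM2r ?exprn_ge0 ?subr_ge0//.
  rewrite -natr1; have : 0 <= (n%:R + 1) * q ^+ 2 by rewrite mulr_ge0 ?addr_ge0 ?sqr_ge0.
  by rewrite expr2; lra.
have mq : 0 <= m%:R * q by rewrite mulr_ge0.
apply: (@le_trans _ _ (prob P (E `&` D) * (1 + m%:R * q))); last by rewrite ler_wpM2r// addr_ge0.
rewrite PED PE PD.
have := bern m; move: ((1 - q) ^+ m) (m%:R * q) p0 => b u p0 h.
have : 0 <= p * (1 - (1 + u) * b) by rewrite mulr_ge0// subr_ge0.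
by lra.
Qed.

(** Boundedness of the single terms gives exceedance probability O(2^-k). The 2^k - 1 columns
    available for a large U supply the second factor 2^-k. *)
Lemma tail_of_dyadic a : 0 < a -> 0 < prob P [set t | a <= `|V 0 0 t|] ->
  exists C k0, forall k, (k0 <= k)%N ->
    prob P [set t | nrm (2 ^ (k + s)) / a <= `|U 0 0 t|] <= C * 2^-1 ^+ (2 * k).
Proof.
move=> a0; set p := prob P _ => p0.
have [B hB] := dyadic.
have peB k : (2 ^ k)%:R * pe (2 ^ k) (nrm (2 ^ (k + s))) <= B.
  apply: le_trans (hB k.+1); rewrite big_nat_recr//= lerDr sumr_ge0// => i _.
  by rewrite mulr_ge0// prob_ge0.
have B0 : 0 <= B by apply: le_trans (peB 0%N); rewrite mulr_ge0// prob_ge0.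
have [k0 hk0] := pow2_gt (2 * B / p).
exists (4 * B / p), k0.+1 => k kk0.
set q := prob P _.
have q0 : 0 <= q by exact: prob_ge0.
pose m := (2 ^ k).-1.
have m1 : m.+1 = (2 ^ k)%N by rewrite /m prednK// expn_gt0.
have mk : (2 ^ k)%:R <= 2 * m%:R :> R.
  rewrite -natrM ler_nat -m1; case: k kk0 @m m1 {q q0} => // k _ m; rewrite expnS; lia.
have := max_tail_bound m (y := nrm (2 ^ (k + s)) / a) (divr_ge0 (nrm_ge0 _) (ltW a0)) (ltW a0).
rewrite -/p -/q m1 divfK ?gt_eqF//.
have := peB k; set e := prob P _ => eB h.
have K0 : (0 : R) < (2 ^ k)%:R by rewrite ltr0n expn_gt0.
have e0 : 0 <= e by exact: prob_ge0.
have ep : 2 * e <= p.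
  have h2 : 2 * B / p < (2 ^ k)%:R.
    by rewrite (lt_le_trans hk0)// ler_nat leq_exp2l// ltnW.
  rewrite ltr_pdivrMr// in h2.
  by rewrite -(ler_pM2l K0); lra.
have mq0 : 0 <= m%:R * q by rewrite mulr_ge0.
(* [m q] absorbs the factor [1 + m q] because [e <= p / 2] *)
have h3 : p * (m%:R * q) <= 2 * e.
  have : 2 * e * (m%:R * q) <= p * (m%:R * q) by rewrite ler_wpM2r.
  by move: h; lra.
have h4 : p * ((2 ^ k)%:R * q) <= 4 * e.
  have : p * ((2 ^ k)%:R * q) <= p * (2 * m%:R * q) by rewrite ler_wpM2l ?(ltW p0)// ler_wpM2r.
  by move: h3; lra.
have h5 : p * ((2 ^ k)%:R * (2 ^ k)%:R * q) <= 4 * B.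
  have : (2 ^ k)%:R * (p * ((2 ^ k)%:R * q)) <= (2 ^ k)%:R * (4 * e) by rewrite ler_pM2l.
  by move: eB; lra.
rewrite exprVn mulnC exprM natrX in h5 *.
have K20 : (0 : R) < 2 ^+ k ^+ 2 by rewrite !exprn_gt0.
rewrite -(ler_pM2r K20) -[leRHS]mulrA mulVf ?gt_eqF// mulr1.
by rewrite ler_pdivlMr//; move: h5; lra.
Qed.

(** Taken at k = 7 i, the tail bound is 4^(-7 i) = 2^(-14 i), while nrm(2^(7 i + s)) / a is of order
    2^(3.5 i) sqrt(i), hence eventually below 16^i = 2^(4 i). *)
Lemma L1_cube_of_dyadic a : 0 < a -> 0 < prob P [set t | a <= `|V 0 0 t|] ->
  L1 P (fun t => `|U 0 0 t| ^+ 3).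
Proof.
move=> a0 pa; have [C [k0 hC]] := tail_of_dyadic a0 pa.
have mU : measurable_fun setT (fun t => `|U 0 0 t|) by exact: measurableT_comp.
have [i0 hi0] := linear_lt_pow2 ((2 ^ s)%:R * (7 + s)%:R / a ^+ 2).
apply: (L1_cube_of_tail (C := C) (i0 := (i0 + k0).+1)) => // i ii0.
have -> : (14 * i = 2 * (7 * i))%N by lia.
apply: le_trans (hC (7 * i)%N _); last by lia.
apply: prob_le; [exact: measurable_ge..|] => t /=; apply: le_trans.
rewrite ler_pdivrMr// -ler_sqr ?nnegrE ?nrm_ge0 ?mulr_ge0 ?exprn_ge0 ?(ltW a0)//.
apply: (le_trans (nrm_pow2_sq_le _)).
have ii : (i0 <= i)%N by lia.
have := hi0 i ii; rewrite mulrAC ler_pdivrMr ?exprn_gt0// => h.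
apply: (@le_trans _ _ ((2 ^ (7 * i))%:R * ((2 ^ i)%:R * a ^+ 2))).
  rewrite expnD natrM -mulrA ler_wpM2l//.
  apply: le_trans h; rewrite mulrAC -mulrA mulrA -mulrA ler_wpM2l// -natrM ler_nat.
  by nia.
rewrite mulrA -natrM -expnD exprMn ler_wpM2r ?sqr_ge0//.
by rewrite -natrX -natrX ler_nat -[16%N]/(2 ^ 4)%N -!expnM leq_exp2l//; lia.
Qed.

End dyadic.
End row_maximum.

(** * Exponential tail of a fixed pair of columns *)

Section product_array.
Context {d : measure_display} {T : measurableType d} {R : realType}
  (P : probability T R) (U V : nat -> nat -> {RV P >-> R}).
Hypothesis iidUV : iid_array P (fun k i => U k i) (fun k i => V k i).

Local Notation Z := (pairUV (fun k i => U k i : T -> R) (fun k i => V k i : T -> R)).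
Local Notation pe n x := (prob P (exceed_at U V (row 0) n x)).

Definition prodUV i j k t := U k i t * V k j t.
Definition pair_cells (i j k : nat) : set (nat * nat) := [set (k, i); (k, j)].

Lemma pair_cells_disjoint i j k l : k != l -> pair_cells i j k `&` pair_cells i j l = set0.
Proof.
move=> kl; apply/seteqP; split => // z [[->|->] [/(congr1 fst)/= e|/(congr1 fst)/= e]];
  by move: kl; rewrite e eqxx.
Qed.

Lemma generated_by_prodUV i j k : generated_by Z (pair_cells i j k) (prodUV i j k).
Proof.
by apply: measurable_funM; [apply: generated_by_U; left|apply: generated_by_V; right].
Qed.

Lemma measurable_prodUV i j k : measurable_fun setT (prodUV i j k).
Proof. exact: measurable_funM. Qed.

(** The components of one pair may be dependent; distinct columns provide the independence of
    [U k i] and [V k j]. *)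
Lemma product_moment (f g : R -> R) i j k : i != j ->
  measurable_fun setT f -> measurable_fun setT g ->
  L1 P (fun t => f (U 0 0 t)) -> L1 P (fun t => g (V 0 0 t)) ->
  L1 P (fun t => f (U k i t) * g (V k j t)) /\
  mean P (fun t => f (U k i t) * g (V k j t)) =
  mean P (fun t => f (U 0 0 t)) * mean P (fun t => g (V 0 0 t)).
Proof.
move=> ij mf mg iU iV.
have mf1 : measurable_fun setT (fun z : R * R => f z.1).
  by apply: measurableT_comp => //; exact: measurable_fst.
have mg2 : measurable_fun setT (fun z : R * R => g z.2).
  by apply: measurableT_comp => //; exact: measurable_snd.
have iU' : L1 P (fun t => f (U k i t)).
  exact: (L1_identical iidUV (ki := (0, 0)%N) (k, i)%N mf1 iU).
have iV' : L1 P (fun t => g (V k j t)).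
  exact: (L1_identical iidUV (ki := (0, 0)%N) (k, j)%N mg2 iV).
have ind (A B : set R) : measurable A -> measurable B ->
    P ((fun t => f (U k i t)) @^-1` A `&` (fun t => g (V k j t)) @^-1` B) =
    (P ((fun t => f (U k i t)) @^-1` A) * P ((fun t => g (V k j t)) @^-1` B))%E.
  apply: (generated_by_independent (measurable_pairUV U V) (independent_pairUV iidUV)
    (K := [set (k, i)]) (L := [set (k, j)])).
  - by apply/seteqP; split => // z [-> [e]]; move: ij; rewrite e eqxx.
  - by apply: measurableT_comp mf _; exact: generated_by_U.
  - by apply: measurableT_comp mg _; exact: generated_by_V.
split; first exact: L1_mul_independent.
rewrite mean_mul_independent//; congr (_ * _).
  exact: (mean_identical iidUV (ki := (0, 0)%N) (k, i)%N mf1 iU).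
exact: (mean_identical iidUV (ki := (0, 0)%N) (k, j)%N mg2 iV).
Qed.

Lemma L1_of_cube (X : T -> R) (n : nat) : (n <= 3)%N -> measurable_fun setT X ->
  L1 P (fun t => `|X t| ^+ 3) -> L1 P (fun t => X t ^+ n).
Proof.
move=> n3 mX iX; apply: (L1_le (Y := fun t => 1 + `|X t| ^+ 3)).
- exact: measurable_funX.
- by apply: L1D => //; exact: L1_cst.
- move=> t; rewrite normrX [leRHS]ger0_norm ?addr_ge0 ?exprn_ge0//.
  have [x1|x1] := leP `|X t| 1.
    by rewrite (le_trans (exprn_ile1 _ _ x1))// lerDl exprn_ge0.
  by rewrite (le_trans (ler_weXn2l (ltW x1) n3))// lerDr.
Qed.

Section tails.
Hypothesis iU3 : L1 P (fun t => `|U 0 0 t| ^+ 3).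
Hypothesis iV3 : L1 P (fun t => `|V 0 0 t| ^+ 3).
Hypothesis mean0 : mean P (U 0 0) * mean P (V 0 0) = 0.
Hypothesis var1 : mean P (fun t => U 0 0 t ^+ 2) * mean P (fun t => V 0 0 t ^+ 2) = 1.

Let K3 := mean P (fun t => `|U 0 0 t| ^+ 3) * mean P (fun t => `|V 0 0 t| ^+ 3).

Let K3_ge0 : 0 <= K3.
Proof. by rewrite mulr_ge0// mean_ge0// => t; rewrite exprn_ge0. Qed.

Lemma centered_prodUV i j k : i != j -> centered P (prodUV i j k) K3.
Proof.
move=> ij.
have iU : L1 P (U 0 0) := L1_of_cube (n := 1) isT (measurable_funP _) iU3.
have iV : L1 P (V 0 0) := L1_of_cube (n := 1) isT (measurable_funP _) iV3.
have iU2 := L1_of_cube (n := 2) isT (measurable_funP (U 0 0)) iU3.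
have iV2 := L1_of_cube (n := 2) isT (measurable_funP (V 0 0)) iV3.
have m2 : measurable_fun setT (fun x : R => x ^+ 2) by exact: measurable_funX.
have m3 : measurable_fun setT (fun x : R => `|x| ^+ 3).
  by apply: measurable_funX; exact: normr_measurable.
have m1 : measurable_fun setT (id : R -> R) by exact: measurable_id.
have [i1 e1] := product_moment k ij m1 m1 iU iV.
have [i2 e2] := product_moment k ij m2 m2 iU2 iV2.
have [i3 e3] := product_moment k ij m3 m3 iU3 iV3.
have E2 : (fun t => prodUV i j k t ^+ 2) = (fun t => U k i t ^+ 2 * V k j t ^+ 2).
  by apply/funext => t; rewrite exprMn.
have E3 : (fun t => `|prodUV i j k t| ^+ 3) = (fun t => `|U k i t| ^+ 3 * `|V k j t| ^+ 3).
  by apply/funext => t; rewrite normrM exprMn.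
split => //; first by rewrite E2.
- by rewrite E3.
- exact: etrans e1 mean0.
- by rewrite E2 E3 e2 e3 var1.
Qed.

Lemma nrm_ge1 n : (1 < n)%N -> 1 <= nrm n :> R.
Proof.
move=> n1; have n0 : (0 : R) < n%:R by rewrite ltr0n ltnW.
rewrite -(@ler_sqr R) ?nnegrE ?nrm_ge0// expr1n nrm_sq.
have : - ln n%:R <= (n%:R)^-1 - 1 :> R.
  rewrite -lnV ?posrE//; have := @le_ln1Dx R (n%:R^-1 - 1).
  rewrite (_ : 1 + (n%:R^-1 - 1) = n%:R^-1); last by ring.
  by apply; rewrite ltrBrDl subrr invr_gt0.
move=> /(ler_wpM2l (ltW n0)); rewrite mulrBr mulfV ?gt_eqF// mulr1.
have : (2 : R) <= n%:R by rewrite ler_nat.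
by lra.
Qed.

(** With l = ln n, squaring reduces the claim to l^3 <= 49 e^(l/2). The cubic term of the
    exponential series already gives the constant 48, hence 7. *)
Lemma nrm_ln_expR_le n : (1 < n)%N ->
  nrm n * ln n%:R * expR (ln n%:R / 4) <= 7 * n%:R :> R.
Proof.
move=> n1; have n0 : (0 : R) < n%:R by rewrite ltr0n ltnW.
have l0 : 0 <= ln n%:R :> R by exact: ln_nat_ge0.
rewrite -(@ler_sqr R) ?nnegrE ?mulr_ge0 ?nrm_ge0 ?expR_ge0// !exprMn nrm_sq.
have l20 : 0 <= ln n%:R / 2 :> R by rewrite divr_ge0.
have := expR_ge1Dxn 2 l20.
have E1 : expR (ln n%:R / 4) ^+ 2 = expR (ln n%:R / 2) :> R.
  by rewrite -expRM_natl; congr expR; lra.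
have E2 : n%:R = expR (ln n%:R / 2) * expR (ln n%:R / 2) :> R.
  by rewrite -expRD -[LHS]lnK ?posrE//; congr expR; lra.
rewrite E1 (_ : 3`! = 6)%N//.
have e0 := expR_gt0 (ln n%:R / 2 : R).
set l := ln n%:R in l0 e0 E2 *; set e := expR (l / 2) in e0 E2 *.
move=> h; rewrite [X in X * l]E2 [X in _ <= _ * X ^+ 2]E2.
have : l ^+ 3 <= 49 * e.
  have : (l / 2) ^+ 3 / 6 = l ^+ 3 / 48 by field.
  by move: h => /[swap] ->; lra.
move=> h2; have := ler_wpM2l (exprn_ge0 3 (ltW e0)) h2.
by rewrite !exprS !expr0; nra.
Qed.

(** Here [lam * L] is [c * eta * ln n], so the factor [expR (lam * L)] is at most n^(1/4), and n
    lam^3 n^(1/4) stays bounded. The truncation term stays bounded too; only the variance term grows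
    like ln n. *)
Lemma exponent_le (c eta : R) (m n : nat) : 0 < c -> 0 < eta -> c * eta <= 4^-1 ->
  (1 < n)%N -> (m <= n)%N ->
  (n - m)%:R * exponent (c * nrm n / n%:R) (eta * nrm n) K3 <=
  ((n - m)%:R / n%:R * c ^+ 2 / 2) * ln n%:R + (c * K3 / eta ^+ 2 + 7 * c ^+ 3 * K3).
Proof.
move=> c0 eta0 ceta n1 mn; have n0 : (0 : R) < n%:R by rewrite ltr0n ltnW.
have N1 := nrm_ge1 n1; have N0 : 0 < nrm n :> R by exact: nrm_gt0.
have l0 : 0 <= ln n%:R :> R by exact: ln_nat_ge0.
have nm0 : 0 <= (n - m)%:R :> R by [].
have nmn : (n - m)%:R <= n%:R :> R by rewrite ler_nat leq_subr.
rewrite /exponent.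
have -> : c * nrm n / n%:R * (eta * nrm n) = c * eta * ln n%:R.
  have := congr1 (fun x : R => x / n%:R) (nrm_sq n).
  rewrite /= [n%:R * _]mulrC mulfK ?gt_eqF// => <-.
  by field; rewrite gt_eqF.
have e1 : expR (c * eta * ln n%:R) <= expR (ln n%:R / 4) :> R.
  by rewrite ler_expR [leRHS]mulrC ler_wpM2r.
have -> : c * nrm n / n%:R / (eta * nrm n) ^+ 2 * K3 = c * K3 / eta ^+ 2 * (n%:R * nrm n)^-1.
  by field; rewrite !gt_eqF.
have -> : (c * nrm n / n%:R) ^+ 2 / 2 = (c ^+ 2 / 2) * ln n%:R / n%:R.
  by rewrite !exprMn nrm_sq; field; rewrite gt_eqF.
have -> : (c * nrm n / n%:R) ^+ 3 = c ^+ 3 * (nrm n * ln n%:R) / n%:R ^+ 2.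
  have -> : (c * nrm n / n%:R) ^+ 3 = c ^+ 3 * (nrm n * nrm n ^+ 2) / n%:R ^+ 3.
    by field; rewrite gt_eqF.
  by rewrite nrm_sq; field; rewrite gt_eqF.
have t1 : (n - m)%:R * (c * K3 / eta ^+ 2 * (n%:R * nrm n)^-1) <= c * K3 / eta ^+ 2.
  rewrite mulrCA ler_piMr//; first by rewrite divr_ge0 ?sqr_ge0// mulr_ge0// ltW.
  rewrite ler_pdivrMr ?mulr_gt0// mul1r.
  by rewrite (le_trans nmn)// ler_peMr// ltW.
have t3 : (n - m)%:R * (c ^+ 3 * (nrm n * ln n%:R) / n%:R ^+ 2 * expR (c * eta * ln n%:R) * K3)
    <= 7 * c ^+ 3 * K3.
  have h := nrm_ln_expR_le n1.
  apply: (@le_trans _ _ (n%:R * (c ^+ 3 * (nrm n * ln n%:R) / n%:R ^+ 2 * expR (ln n%:R / 4) * K3))).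
    have A0 : 0 <= c ^+ 3 * (nrm n * ln n%:R) / n%:R ^+ 2.
      by rewrite divr_ge0 ?mulr_ge0 ?exprn_ge0// ltW.
    apply: ler_pM => //.
      by apply: mulr_ge0 => //; apply: mulr_ge0 => //; exact: expR_ge0.
    by rewrite ler_wpM2r// ler_wpM2l.
  have -> : n%:R * (c ^+ 3 * (nrm n * ln n%:R) / n%:R ^+ 2 * expR (ln n%:R / 4) * K3) =
     c ^+ 3 * K3 * ((nrm n * ln n%:R * expR (ln n%:R / 4)) / n%:R).
    by field; rewrite gt_eqF.
  have -> : 7 * c ^+ 3 * K3 = c ^+ 3 * K3 * 7 by ring.
  rewrite ler_wpM2l//; first by rewrite mulr_ge0// exprn_ge0// ltW.
  by rewrite ler_pdivrMr.
move: t1 t3; rewrite !mulrDr.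
have -> : (n - m)%:R * (c ^+ 2 / 2 * ln n%:R / n%:R) = (n - m)%:R / n%:R * c ^+ 2 / 2 * ln n%:R.
  by field; rewrite gt_eqF.
by lra.
Qed.

Lemma pair_tail (c eta : R) : 0 < c -> 0 < eta -> c * eta <= 4^-1 ->
  exists2 B, 0 <= B & forall i j m n x, i != j -> (1 < n)%N -> (m <= n)%N ->
    prob P [set t | x * nrm n <= `|\sum_(m <= k < n) trunc (eta * nrm n) (prodUV i j k t)|] <=
    B * expR ((- (c * x) + (n - m)%:R / n%:R * c ^+ 2 / 2) * ln n%:R).
Proof.
move=> c0 eta0 ceta.
exists (2 * expR (c * K3 / eta ^+ 2 + 7 * c ^+ 3 * K3)); first by rewrite mulr_ge0// expR_ge0.
move=> i j m n x ij n1 mn.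
have n0 : (0 : R) < n%:R by rewrite ltr0n ltnW.
have N0 : 0 < nrm n :> R by exact: nrm_gt0.
have lam0 : 0 < c * nrm n / n%:R by rewrite divr_gt0 ?mulr_gt0.
have L0 : 0 < eta * nrm n by rewrite mulr_gt0.
apply: (le_trans (sum_trunc_tail (measurable_pairUV U V) (independent_pairUV iidUV)
  (@pair_cells_disjoint i j) (x * nrm n) mn lam0 L0
  (fun k => @generated_by_prodUV i j k) (fun k => centered_prodUV k ij))).
rewrite -[leRHS]mulrA ler_pM2l// -expRD ler_expR.
have -> : c * nrm n / n%:R * (x * nrm n) = c * x * ln n%:R.
  have -> : c * nrm n / n%:R * (x * nrm n) = c * x * (nrm n ^+ 2) / n%:R.
    by field; rewrite gt_eqF.
  by rewrite nrm_sq; field; rewrite gt_eqF.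
have := exponent_le c0 eta0 ceta n1 mn.
rewrite [X in _ -> _ <= _ + X]mulrDl mulNr.
by lra.
Qed.

End tails.
End product_array.

(** * The upper bound *)

Section upper_bound.
Context {d : measure_display} {T : measurableType d} {R : realType}
  (P : probability T R) (U V : nat -> nat -> {RV P >-> R}).
Hypothesis iidUV : iid_array P (fun k i => U k i) (fun k i => V k i).
Hypothesis iU3 : L1 P (fun t => `|U 0 0 t| ^+ 3).
Hypothesis iV3 : L1 P (fun t => `|V 0 0 t| ^+ 3).
Hypothesis mean0 : mean P (U 0 0) * mean P (V 0 0) = 0.
Hypothesis var1 : mean P (fun t => U 0 0 t ^+ 2) * mean P (fun t => V 0 0 t ^+ 2) = 1.

Local Notation pe n x := (prob P (exceed_at U V (row 0) n x)).
Local Notation S i j m n L t := (\sum_(m <= k < n) trunc L (prodUV U V i j k t)).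

Hypothesis dyadic :
  forall r, bounded_sums (fun k => (2 ^ k)%:R * pe (2 ^ (k + r)) (nrm (2 ^ k))).

Variable p : nat -> nat.

Let measurable_exists3 (F : nat -> nat -> nat -> set T) (A N : nat) :
  (forall a i j, measurable (F a i j)) ->
  measurable [set t | exists2 a, (a < A)%N & exists2 i, (i < N)%N &
    exists2 j, (j < N)%N & F a i j t].
Proof.
by move=> mF; do 3 (apply: measurable_exists_lt => ? _).
Qed.

Let prob_exists3_le (F : nat -> nat -> nat -> set T) (A N : nat) (c : R) :
  (forall a i j, measurable (F a i j)) ->
  (forall a i j, (a < A)%N -> prob P (F a i j) <= c) ->
  prob P [set t | exists2 a, (a < A)%N & exists2 i, (i < N)%N &
    exists2 j, (j < N)%N & F a i j t] <= A%:R * (N%:R * (N%:R * c)).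
Proof.
move=> mF hF.
apply: prob_exists_lt_le => [a _|a aA]; first by do 2 (apply: measurable_exists_lt => ? _).
apply: prob_exists_lt_le => [i _|i _]; first by apply: measurable_exists_lt.
by apply: prob_exists_lt_le => // j _; exact: hF.
Qed.

Let pow2_expR k : (2 ^ k)%:R = expR (k%:R * ln 2) :> R.
Proof. by rewrite natrX expRM_natl lnK// posrE. Qed.

Let ln2_gt0 : 0 < ln 2 :> R.
Proof. by rewrite ln_gt0// ltr1n. Qed.

Let ln_ge k n : (2 ^ k <= n)%N -> k%:R * ln 2 <= ln n%:R :> R.
Proof.
move=> kn; rewrite -ler_expR -pow2_expR lnK ?ler_nat// posrE ltr0n.
by rewrite (leq_trans _ kn)// expn_gt0.
Qed.

Variable eps : R.
Hypothesis eps_gt0 : 0 < eps.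

(** Small enough for c eta <= 1/4 with both values of c in use, 2 and 10 / eps. *)
Let eta : R := (8 + 40 / eps)^-1.

Let eta_gt0 : 0 < eta.
Proof. by rewrite invr_gt0 addr_gt0// divr_gt0. Qed.

Let eta2 : 2 * eta <= 4^-1.
Proof.
have e40 : 0 < 40 / eps by rewrite divr_gt0.
by rewrite /eta ler_pdivrMr ?addr_gt0//; lra.
Qed.

Let eta10 : 10 / eps * eta <= 4^-1.
Proof.
have e40 : 0 < 40 / eps by rewrite divr_gt0.
rewrite /eta ler_pdivrMr ?addr_gt0//.
have -> : 40 / eps = 4 * (10 / eps) by field; rewrite gt_eqF.
by lra.
Qed.

(** [s] is the fineness of the grid: [s_eta] makes the level eta nrm(2^(k+s)) dominate the threshold
    nrm(2^k) of [dyadic], and [s_eps] keeps the variance term of the increments below ln n. [r]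
    absorbs the ratio of [p n] to n. *)
Variables s r : nat.
Hypothesis s_eta : 1 <= eta ^+ 2 * (2 ^ s)%:R.
Hypothesis s_eps : (10 / eps) ^+ 2 / 2 <= (2 ^ s)%:R.
Hypothesis p_le_pow2 : forall k n, (2 ^ (k + s) <= n < 2 ^ (k + s).+1)%N ->
  (p n <= 2 ^ (k + r))%N.

(** The guard empties the event outside the intended indices, so that the unions may run over
    initial segments of [nat]. *)
Let grid_set k q i j : set T := if (2 ^ s <= q)%N && (i != j) then
  [set t | (2 + eps) * nrm (2 ^ k * q) <=
    `|S i j 0 (2 ^ k * q) (eta * nrm (2 ^ k * q)) t|] else set0.

Let gap_set k n i j : set T := if (2 ^ (k + s) <= n)%N && (i != j) then
  [set t | eps * nrm n <= `|S i j (2 ^ k * (n %/ 2 ^ k)) n (eta * nrm n) t|] else set0.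

Let measurable_tail i j m n L y : measurable [set t | y <= `|S i j m n L t|].
Proof.
apply: measurable_ge; apply: measurableT_comp => //.
apply: measurable_sum => k.
by apply: measurableT_comp (measurable_trunc L) _; exact: measurable_prodUV.
Qed.

Let measurable_grid k q i j : measurable (grid_set k q i j).
Proof. by rewrite /grid_set; case: ifP => // _; exact: measurable_tail. Qed.

Let measurable_gap k n i j : measurable (gap_set k n i j).
Proof. by rewrite /gap_set; case: ifP => // _; exact: measurable_tail. Qed.

Let grid k := [set t | exists2 q, (q < 2 ^ s.+1)%N & exists2 i, (i < 2 ^ (k + r))%N &
    exists2 j, (j < 2 ^ (k + r))%N & grid_set k q i j t].

Let gap k := [set t | exists2 n, (n < 2 ^ (k + s).+1)%N & exists2 i, (i < 2 ^ (k + r))%N &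
    exists2 j, (j < 2 ^ (k + r))%N & gap_set k n i j t].

Let large k := [set t | exists2 h, (h < 2 ^ (k + s).+1)%N &
  exceed_at U V (row h) (2 ^ (k + r)) (eta * nrm (2 ^ (k + s))) t].

(** The exponent is - 2 (2 + eps) + 2 = - (2 + 2 eps). The 4^(k+r) pairs cancel 2^(-2 k), and 2^(-2
    eps k) remains. *)
Let bounded_sums_grid : bounded_sums (fun k => prob P (grid k)).
Proof.
have [B B0 hB] := pair_tail iidUV iU3 iV3 mean0 var1 (ltr0n R 2) eta_gt0 eta2.
pose w := expR (- (2 * eps * ln 2)).
apply: (bounded_sums_le (C := (2 ^ s.+1)%:R * ((2 ^ r)%:R * ((2 ^ r)%:R * B)))
  (N := 1) (v := fun k => w ^+ k)).
- by rewrite !mulr_ge0.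
- by move=> k; rewrite exprn_ge0// expR_ge0.
- move=> k k1.
  have h q i j : (q < 2 ^ s.+1)%N ->
      prob P (grid_set k q i j) <= B * expR (- (2 + 2 * eps) * (k%:R * ln 2)).
    move=> qs; rewrite /grid_set; case: ifPn => [/andP[sq ij]|_]; last first.
      by rewrite /prob measure0 mulr_ge0 ?expR_ge0.
    have q0 : (0 < q)%N by rewrite (leq_trans _ sq)// expn_gt0.
    have kn : (2 ^ k <= 2 ^ k * q)%N by rewrite leq_pmulr.
    have n1 : (1 < 2 ^ k * q)%N.
      by rewrite (leq_trans _ kn)// -[1%N]/(2 ^ 0)%N ltn_exp2l.
    apply: (le_trans (hB i j 0%N _ (2 + eps) ij n1 (leq0n _))).
    rewrite ler_wpM2l// ler_expR subn0 divff ?gt_eqF ?ltr0n ?(ltnW n1)//.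
    have := ln_ge kn; set l' := _ * ln 2; set l := ln _ => ll.
    have : (2 + 2 * eps) * l' <= (2 + 2 * eps) * l by rewrite ler_wpM2l// addr_ge0// mulr_ge0// ltW.
    by move: ll eps_gt0 => _ _; lra.
  apply: (le_trans (prob_exists3_le (2 ^ (k + r)) (@measurable_grid k) h)).
  rewrite -[w ^+ k]expRM_natl.
  have -> : k%:R * - (2 * eps * ln 2) = k%:R * ln 2 + (k%:R * ln 2 + - (2 + 2 * eps) * (k%:R * ln 2)).
    by ring.
  rewrite !expRD -pow2_expR expnD natrM.
  by rewrite le_eqVlt; apply/orP; left; apply/eqP; ring.
- by apply: bounded_sums_geometric; [exact: expR_ge0|rewrite expR_lt1 oppr_lt0 !mulr_gt0].
Qed.

(** The exponent is at most - 10 + 1 = - 9. The number of times and of pairs costs three factors of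
    order 2^k, leaving 2^(-6 k). *)
Let bounded_sums_gap : bounded_sums (fun k => prob P (gap k)).
Proof.
have c0 : 0 < 10 / eps by rewrite divr_gt0.
have [B B0 hB] := pair_tail iidUV iU3 iV3 mean0 var1 c0 eta_gt0 eta10.
pose w : R := expR (- (6 * ln 2)).
apply: (bounded_sums_le (C := (2 ^ s.+1)%:R * ((2 ^ r)%:R * ((2 ^ r)%:R * B)))
  (N := 1) (v := fun k => w ^+ k)).
- by rewrite !mulr_ge0.
- by move=> k; rewrite exprn_ge0// expR_ge0.
- move=> k k1.
  have h n i j : (n < 2 ^ (k + s).+1)%N ->
      prob P (gap_set k n i j) <= B * expR (- 9 * (k%:R * ln 2)).
    move=> ns; rewrite /gap_set; case: ifPn => [/andP[sn ij]|_]; last first.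
      by rewrite /prob measure0 mulr_ge0 ?expR_ge0.
    have kn : (2 ^ k <= n)%N by rewrite (leq_trans _ sn)// leq_exp2l// leq_addr.
    have n1 : (1 < n)%N by rewrite (leq_trans _ kn)// -[1%N]/(2 ^ 0)%N ltn_exp2l.
    have n0 : (0 : R) < n%:R by rewrite ltr0n ltnW.
    have mn : (2 ^ k * (n %/ 2 ^ k) <= n)%N by rewrite mulnC leq_trunc_div.
    apply: (le_trans (hB i j _ _ eps ij n1 mn)).
    rewrite ler_wpM2l// ler_expR.
    (* The length of the increment is the remainder of n modulo 2^k, hence at most n / 2^s; [s_eps]
       was chosen for this. *)
    have h1 : (n - 2 ^ k * (n %/ 2 ^ k))%:R / n%:R * (10 / eps) ^+ 2 / 2 <= 1.
      have e : (n - 2 ^ k * (n %/ 2 ^ k) = n %% 2 ^ k)%N by rewrite {1}(divn_eq n (2 ^ k)) mulnC addKn.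
      rewrite e -mulrA mulrAC ler_pdivrMr// mul1r.
      apply: (@le_trans _ _ ((2 ^ k)%:R * (2 ^ s)%:R)).
        by apply: ler_pM => //; rewrite ?divr_ge0 ?sqr_ge0// ler_nat ltnW// ltn_pmod// expn_gt0.
      by rewrite -natrM -expnD ler_nat.
    have -> : 10 / eps * eps = 10 by rewrite divfK// gt_eqF.
    have := ln_ge kn; set l' := _ * ln 2; set l := ln _ => ll.
    have l0 : 0 <= l by exact: ln_nat_ge0.
    move: h1; set a := _ / 2 => h1.
    have : a * l <= 1 * l by rewrite ler_wpM2r.
    by lra.
  apply: (le_trans (prob_exists3_le (2 ^ (k + r)) (@measurable_gap k) h)).
  rewrite -[w ^+ k]expRM_natl.
  have -> : k%:R * - (6 * ln 2) = k%:R * ln 2 + (k%:R * ln 2 + (k%:R * ln 2 + - 9 * (k%:R * ln 2))) :> R.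
    by ring.
  rewrite !expRD -pow2_expR -addnS !expnD !natrM.
  by rewrite le_eqVlt; apply/orP; left; apply/eqP; ring.
- by apply: bounded_sums_geometric; [exact: expR_ge0|rewrite expR_lt1 oppr_lt0 !mulr_gt0].
Qed.

(** The weight 2^k of the dyadic condition is, up to the factor 2^(s+1), the number of rows in the
    union bound. *)
Let bounded_sums_large : bounded_sums (fun k => prob P (large k)).
Proof.
apply: (bounded_sums_le (C := (2 ^ s.+1)%:R) (N := 0) _ _ _ (dyadic r)) => //.
  by move=> k; rewrite mulr_ge0// prob_ge0.
move=> k _.
have h a : prob P (exceed_at U V (row a) (2 ^ (k + r)) (eta * nrm (2 ^ (k + s)))) <=
    pe (2 ^ (k + r)) (nrm (2 ^ k)).
  rewrite (prob_exceed_at iidUV _ _ (@row_inj a) (@row_inj 0)).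
  apply: prob_le; [exact: measurable_exceed_at..|].
  by apply: exceed_mono => //; apply: nrm_pow2_scale => //; exact: ltW.
apply: (le_trans (prob_exists_lt_le (c := pe (2 ^ (k + r)) (nrm (2 ^ k))) _ _)).
- by move=> a _; exact: measurable_exceed_at.
- by move=> a _; exact: h.
- by rewrite -addnS expnD natrM -mulrA mulrCA mulrA.
Qed.

Let Tn_le_of_good k t n : (0 < k)%N -> ~ grid k t -> ~ gap k t -> ~ large k t ->
  (2 ^ (k + s) <= n < 2 ^ (k + s).+1)%N ->
  Tn (fun k i => U k i : T -> R) (fun k i => V k i : T -> R) p n t <=
  (2 + 2 * eps) * nrm n.
Proof.
move=> k0 ngrid ngap nlarge kn; have pn := p_le_pow2 kn; move/andP: kn => [kn nk].
have C0 : 0 <= (2 + 2 * eps) * nrm n by rewrite mulr_ge0 ?nrm_ge0// addr_ge0// mulr_ge0// ltW.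
apply: bigmax_le => // -[i ip] _; apply: bigmax_le => // -[j jp] /= ij.
have {}ij : i != j by apply: contra ij => /eqP e; apply/eqP/val_inj.
have ir : (i < 2 ^ (k + r))%N by exact: leq_trans pn.
have jr : (j < 2 ^ (k + r))%N by exact: leq_trans pn.
pose q := (n %/ 2 ^ k)%N; pose n' := (2 ^ k * q)%N.
have n'n : (n' <= n)%N by rewrite /n' mulnC leq_trunc_div.
have sq : (2 ^ s <= q)%N by rewrite leq_divRL ?expn_gt0// -expnD addnC.
have qs : (q < 2 ^ s.+1)%N by rewrite ltn_divLR ?expn_gt0// -expnD addnC addnS.
have n'ge : (2 ^ (k + s) <= n')%N by rewrite expnD leq_mul2l sq orbT.
(* Off [large k] truncation changes no entry, at the level of [n'] as well as at that of [n], so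
   both truncated sums are true partial sums. *)
have small h L : (h < n)%N -> eta * nrm (2 ^ (k + s)) <= L ->
    trunc L (prodUV U V i j h t) = U h i t * V h j t.
  move=> hn hL; rewrite /trunc ifT// (le_trans _ hL)// leNgt; apply/negP => hlt.
  apply: nlarge; exists h; first exact: ltn_trans nk.
  by exists i => //; exists j => //; rewrite ij /= ltW.
have L1' : eta * nrm (2 ^ (k + s)) <= eta * nrm n' by rewrite ler_pM2l// le_nrm.
have L2' : eta * nrm (2 ^ (k + s)) <= eta * nrm n by rewrite ler_pM2l// le_nrm.
rewrite -(big_mkord xpredT (fun h => U h i t * V h j t)) (big_cat_nat (leq0n n') n'n) /=.
apply: (le_trans (ler_normD _ _)).
have A1 : `|\sum_(0 <= h < n') U h i t * V h j t| <= (2 + eps) * nrm n.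
  apply: (@le_trans _ _ ((2 + eps) * nrm n')); last first.
    by rewrite ler_wpM2l ?le_nrm// addr_ge0// ltW.
  rewrite leNgt; apply/negP => hlt; apply: ngrid.
  exists q => //; exists i => //; exists j => //; rewrite /grid_set sq ij /=.
  rewrite (eq_big_nat _ _ (F2 := fun h => U h i t * V h j t)); first exact: ltW.
  by move=> h /andP[_ hn']; apply: small => //; exact: leq_trans n'n.
have A2 : `|\sum_(n' <= h < n) U h i t * V h j t| <= eps * nrm n.
  rewrite leNgt; apply/negP => hlt; apply: ngap.
  exists n => //; exists i => //; exists j => //; rewrite /gap_set kn ij /=.
  rewrite (eq_big_nat _ _ (F2 := fun h => U h i t * V h j t)); first exact: ltW.
  by move=> h /andP[_ hn]; exact: small.
by have := lerD A1 A2; lra.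
Qed.

Lemma ae_Tn_le_of_scales : {ae P, forall t, exists N, forall n, (N <= n)%N ->
  Tn (fun k i => U k i : T -> R) (fun k i => V k i : T -> R) p n t <= (2 + 2 * eps) * nrm n}.
Proof.
have mgrid k : measurable (grid k) by exact: measurable_exists3 (@measurable_grid k).
have mgap k : measurable (gap k) by exact: measurable_exists3 (@measurable_gap k).
have mlarge k : measurable (large k).
  by apply: measurable_exists_lt => h _; exact: measurable_exceed_at.
have := borel_cantelli mgrid bounded_sums_grid.
have := borel_cantelli mgap bounded_sums_gap.
have := borel_cantelli mlarge bounded_sums_large.
apply: filterS3 => t [N1 h1] [N2 h2] [N3 h3].
pose N := (N1 + N2 + N3).+1.
exists (2 ^ (N + s))%N => n Nn.
have n0 : (0 < n)%N by rewrite (leq_trans _ Nn)// expn_gt0.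
have [l1 l2] := andP (trunc_log_bounds (ltnSn 1) n0).
have Nl : (N + s <= trunc_log 2 n)%N.
  by rewrite -ltnS -(ltn_exp2l _ _ (ltnSn 1)) (leq_ltn_trans Nn).
have e : (trunc_log 2 n - s + s = trunc_log 2 n)%N.
  exact: subnK (leq_trans (leq_addl N s) Nl).
have NL : (N <= trunc_log 2 n - s)%N by rewrite -(leq_add2r s) e.
(* [trunc_log 2 n] is the index k + s of the dyadic block containing [n]. *)
apply: (@Tn_le_of_good (trunc_log 2 n - s)).
- exact: leq_trans NL.
- by apply: h3; apply: leq_trans NL; rewrite /N ltnW// ltnS leq_addl.
- by apply: h2; apply: leq_trans NL; rewrite /N ltnW// ltnS addnAC leq_addl.
- by apply: h1; apply: leq_trans NL; rewrite /N ltnW// ltnS -addnA leq_addr.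
- by rewrite e l1 l2.
Qed.

End upper_bound.

Section upper_bound_limsup.
Context {d : measure_display} {T : measurableType d} {R : realType}
  (P : probability T R) (U V : nat -> nat -> {RV P >-> R}).
Hypothesis iidUV : iid_array P (fun k i => U k i) (fun k i => V k i).
Hypothesis iU3 : L1 P (fun t => `|U 0 0 t| ^+ 3).
Hypothesis iV3 : L1 P (fun t => `|V 0 0 t| ^+ 3).
Hypothesis mean0 : mean P (U 0 0) * mean P (V 0 0) = 0.
Hypothesis var1 : mean P (fun t => U 0 0 t ^+ 2) * mean P (fun t => V 0 0 t ^+ 2) = 1.
Hypothesis dyadic : forall r, bounded_sums (fun k =>
  (2 ^ k)%:R * prob P (exceed_at U V (row 0) (2 ^ (k + r)) (nrm (2 ^ k)))).
Variables (p : nat -> nat) (c1 : R).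
Hypothesis c1_gt0 : 0 < c1.
Hypothesis p_gt0 : forall n, (0 < n)%N -> (0 < p n)%N.
Hypothesis p_le : forall n, (0 < n)%N -> c1 <= n%:R / (p n)%:R.

Lemma ae_Tn_le (eps : R) : 0 < eps -> {ae P, forall t, exists N, forall n, (N <= n)%N ->
  Tn (fun k i => U k i : T -> R) (fun k i => V k i : T -> R) p n t <= (2 + 2 * eps) * nrm n}.
Proof.
move=> eps0; pose eta : R := (8 + 40 / eps)^-1.
have eta0 : 0 < eta by rewrite invr_gt0 addr_gt0// divr_gt0.
have [s hs] := pow2_gt (eta ^- 2 + (10 / eps) ^+ 2 / 2).
have [t0 ht0] := pow2_gt c1^-1.
(* Since p n <= n / c1 with n < 2^(k+s+1) and 1 / c1 < 2^t0, the column shift is s + 1 + t0. *)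
apply: (@ae_Tn_le_of_scales _ _ _ _ _ _ iidUV iU3 iV3 mean0 var1 dyadic p eps eps0 s (s.+1 + t0)%N).
- rewrite -(ler_pM2l (_ : 0 < eta ^- 2)) ?invr_gt0 ?exprn_gt0//.
  rewrite mulrA mulVf ?mul1r ?mulr1 ?expf_neq0 ?gt_eqF//.
  by apply: ltW; apply: le_lt_trans hs; rewrite lerDl divr_ge0 ?sqr_ge0.
- by apply: ltW; apply: le_lt_trans hs; rewrite lerDr invr_ge0 exprn_ge0// ltW.
- move=> k n /andP[kn nk]; have n0 : (0 < n)%N by rewrite (leq_trans _ kn)// expn_gt0.
  have pn0 : (0 : R) < (p n)%:R by rewrite ltr0n p_gt0.
  have := p_le n0; rewrite ler_pdivlMr// => h.
  rewrite -(ler_nat R) -(ler_pM2l c1_gt0) (le_trans h)//.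
  rewrite addnA addnS expnD natrM mulrCA.
  have h1 : 1 <= c1 * (2 ^ t0)%:R by rewrite -ler_pdivrMl// mulr1 ltW.
  by rewrite (@le_trans _ _ (2 ^ (k + s).+1)%:R)// ?ler_nat 1?ltnW// ler_peMr.
Qed.

Lemma ae_limsup_Tn_le : {ae P, forall t, (limn_esup (fun n =>
  (Tn (fun k i => U k i : T -> R) (fun k i => V k i : T -> R) p n t / nrm n)%:E) <= 2%:E)%E}.
Proof.
have h m : {ae P, forall t, exists N, forall n, (N <= n)%N ->
    Tn (fun k i => U k i : T -> R) (fun k i => V k i : T -> R) p n t <=
    (2 + 2 * m.+1%:R^-1) * nrm n} by exact: ae_Tn_le.
have := ae_foralln h; apply: filterS => t ht.
apply/lee_addgt0Pr => e e0.
have [m hm] := nat_gt (2 / e).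
have [N hN] := ht m.
rewrite limn_esup_lim; apply: lime_le; first exact: is_cvg_esups.
exists (N + 2)%N => // n /= Nn; apply: ge_ereal_sup => _ [k /= nk <-].
rewrite -EFinD lee_fin ler_pdivrMr ?nrm_gt0//; last lia.
apply: le_trans (hN k _) _; first lia.
rewrite ler_wpM2r ?nrm_ge0// lerD2l ler_pdivrMr// mulrC -ler_pdivrMr//.
by rewrite (le_trans (ltW hm))// ler_nat.
Qed.

End upper_bound_limsup.

(** * The converse *)

Section second_borel_cantelli.
Context {d d' : measure_display} {T : measurableType d} {S : measurableType d'}
  {R : realType} {I : choiceType} (P : probability T R) (Z : I -> T -> S).
Hypothesis mZ : forall j, measurable_fun setT (Z j).
Hypothesis iZ : mutually_independent P Z.
Variable K : nat -> set I.
Hypothesis disjointK : forall k l, k != l -> K k `&` K l = set0.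

Lemma prod_1B_le_expR (a : nat -> R) n : (forall k, 0 <= a k <= 1) ->
  \prod_(0 <= k < n) (1 - a k) <= expR (- \sum_(0 <= k < n) a k).
Proof.
move=> ha; rewrite -sumrN expR_sum; apply: ler_prod => k _.
by have /andP[a0 a1] := ha k; rewrite subr_ge0 a1 expR_ge1Dx.
Qed.

(** If no event occurs from [N] on with positive probability P(E), then P(E) <= e^(-S) <= 1 / (1 +
    S) for every partial sum S, so the sums are bounded by 1 / P(E). Emptying the events before [N]
    keeps them unbounded. *)
Lemma borel_cantelli2 (A : nat -> set T) : (forall k, <<s cylinders Z (K k) >> (A k)) ->
  ~ bounded_sums (fun k => prob P (A k)) ->
  {ae P, forall t, forall N, exists2 k, (N <= k)%N & A k t}.
Proof.
move=> sA nb; apply: ae_foralln => N.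
have mA k : measurable (A k) by exact: sigma_cylinders_measurable (sA k).
pose A' k := if (N <= k)%N then A k else set0.
have sA' k : <<s cylinders Z (K k) >> (A' k).
  by rewrite /A'; case: ifP => // _; exact: (@sigma_algebra0 _ setT (cylinders Z (K k))).
have mA' k : measurable (A' k) by exact: sigma_cylinders_measurable (sA' k).
have nb' : ~ bounded_sums (fun k => prob P (A' k)).
  apply: contra_not nb; apply: (bounded_sums_le (C := 1) (N := N)) => // k.
    exact: prob_ge0.
  by move=> Nk; rewrite mul1r /A' Nk.
pose E := \bigcap_(k in [set k | (N <= k)%N]) ~` A k.
have mE : measurable E by apply: bigcap_measurable => [|k _]; [exists N => /=|exact: measurableC].
exists E; split => //; last first.
  move=> t h k /= Nk Ak; apply: h; by exists k.
apply: etrans (probE P mE) _; congr EFin; apply/eqP; rewrite eq_le prob_ge0 andbT leNgt.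
apply/negP => E0; apply: nb'; exists (prob P E)^-1 => n.
rewrite leNgt; apply/negP => hn.
have : prob P E <= expR (- \sum_(0 <= k < n) prob P (A' k)).
  apply: le_trans (prod_1B_le_expR n _); last by move=> k; rewrite prob_ge0 prob_le1.
  rewrite -(prob_no_event mZ iZ disjointK n sA').
  apply: prob_le => //; first by apply: measurableC; exact: measurable_exists_lt.
  move=> t Et [k kn]; rewrite /A'; case: ifP => // Nk; exact: Et.
apply/negP; rewrite -ltNge.
have S0 : 0 < \sum_(0 <= k < n) prob P (A' k) by apply: lt_trans hn; rewrite invr_gt0.
rewrite expRN -[ltRHS]invrK ltf_pV2 ?posrE ?expR_gt0 ?invr_gt0//.
apply: (lt_le_trans hn); apply: le_trans (expR_ge1Dx _).
by rewrite lerDr.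
Qed.

End second_borel_cantelli.

Section swap.
Context {d : measure_display} {T : measurableType d} {R : realType}
  (P : probability T R) (U V : nat -> nat -> {RV P >-> R}).

(** Allows the third-moment argument for U to be reused for V. *)
Lemma iid_array_swap : iid_array P (fun k i => U k i) (fun k i => V k i) ->
  iid_array P (fun k i => V k i) (fun k i => U k i).
Proof.
move=> [h1 h2].
pose sw (A : set (R * R)) : set (R * R) := (fun z => (z.2, z.1)) @^-1` A.
have msw A : measurable A -> measurable (sw A).
  move=> mA; rewrite -[sw A]setTI.
  have : measurable_fun setT (fun z : R * R => (z.2, z.1)).
    by apply: measurable_fun_pair; [exact: measurable_snd|exact: measurable_fst].
  exact.
split; first by move=> ki A mA; exact: (h1 ki (sw A) (msw _ mA)).
by move=> J A mA; exact: (h2 J (fun j => sw (A j)) (fun j => msw _ (mA j))).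
Qed.

Lemma exceed_at_swap phi n x : exceed_at V U phi n x = exceed_at U V phi n x.
Proof.
rewrite /exceed_at /exceed; apply/seteqP; split => t [i im [j jm /andP[ij xij]]];
  by exists j => //; exists i => //; rewrite eq_sym ij mulrC.
Qed.

End swap.

Section almost_everywhere.
Context {d : measure_display} {T : measurableType d} {R : realType} (P : probability T R).

Lemma ae_not_false : ~ {ae P, forall t, False}.
Proof.
move=> [A [mA PA0 sA]].
have : (1 <= P A)%E.
  by rewrite -(probability_setT P); apply: le_measure; rewrite ?inE// => t _; exact: sA.
by rewrite PA0 lee_fin ler10.
Qed.

Lemma expectation_mean (X : T -> R) : L1 P X -> ('E_P[X] = (mean P X)%:E)%E.
Proof. by move=> iX; rewrite unlock integral_mean. Qed.

Lemma expectation_ae0 (X : T -> R) : measurable_fun setT X -> {ae P, forall t, X t = 0} ->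
  ('E_P[X] = 0)%E.
Proof.
move=> mX X0; rewrite unlock (ae_eq_integral (cst 0%E)) ?integral0//.
  exact/measurable_EFinP.
by apply: filterS X0 => t /= -> _.
Qed.

Lemma limn_esup_lt_pinfty (u : nat -> R) : (limn_esup (fun n => (u n)%:E) < +oo)%E ->
  exists C N, forall n, (N <= n)%N -> u n <= C.
Proof.
rewrite /limn_esup limf_esupE => /ereal_inf_lt[_ [A [N _ NA] <-]].
case E : (ereal_sup _) => [C| |] // _.
  exists C, N => n Nn; rewrite -lee_fin -E; apply: ereal_sup_ubound.
  by exists n => //; exact: NA.
exists 0, N => n Nn.
have : ((u n)%:E <= -oo)%E by rewrite -E; apply: ereal_sup_ubound; exists n => //; exact: NA.
by [].
Qed.

End almost_everywhere.

Section converse.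
Context {d : measure_display} {T : measurableType d} {R : realType}
  (P : probability T R) (U V : nat -> nat -> {RV P >-> R}).
Hypothesis iidUV : iid_array P (fun k i => U k i) (fun k i => V k i).
Variables (p : nat -> nat) (c2 : R).
Hypothesis p_gt0 : forall n, (0 < n)%N -> (0 < p n)%N.
Hypothesis p_ge : forall n, (0 < n)%N -> n%:R / (p n)%:R <= c2.

Local Notation Z := (pairUV (fun k i => U k i : T -> R) (fun k i => V k i : T -> R)).
Local Notation pe n x := (prob P (exceed_at U V (row 0) n x)).
Local Notation Tmax := (Tn (fun k i => U k i : T -> R) (fun k i => V k i : T -> R) p).

Hypothesis limsup_finite : {ae P, forall t,
  (limn_esup (fun n => (Tmax n t / nrm n)%:E) < +oo)%E}.

(** One natural number is both the constant and the starting index: the random constant then ranges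
    over a countable set, as intersecting almost sure events requires. *)
Lemma ae_Tn_bounded : {ae P, forall t, exists m : nat, forall n, (m <= n)%N ->
  Tmax n t <= m%:R * nrm n}.
Proof.
apply: filterS limsup_finite => t /limn_esup_lt_pinfty[C [N hC]].
have [c Cc] := nat_gt C.
exists (c + N + 2)%N => n hn; have n1 : (1 < n)%N by lia.
have := hC n ltac:(lia); rewrite ler_pdivrMr ?nrm_gt0// => /le_trans; apply.
rewrite ler_wpM2r ?nrm_ge0// (le_trans (ltW Cc))// ler_nat.
by rewrite -addnA leq_addr.
Qed.

Lemma le_Tn n i j t : (i < p n)%N -> (j < p n)%N -> i != j ->
  `|\sum_(0 <= k < n) prodUV U V i j k t| <= Tmax n t.
Proof.
move=> ip jp ij; rewrite big_mkord.
apply/bigmax_geP; right; exists (Ordinal ip) => //.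
by apply/bigmax_geP; right; exists (Ordinal jp).
Qed.

Lemma dyadic_of_limsup : exists s,
  bounded_sums (fun k => (2 ^ k)%:R * pe (2 ^ k) (nrm (2 ^ (k + s)))).
Proof.
pose q n := minn (p n) (p n.+1).
(* An entry of row n is the difference of two partial sums, each at most C nrm(n+1); the extra 1
   makes the contradiction strict. *)
pose A (C n : nat) := exceed_at U V (row n) (q n) ((2 * C + 1)%:R * nrm n.+1).
pose K n : set (nat * nat) := [set z | z.1 = n].
have dK k l : k != l -> K k `&` K l = set0.
  by move=> kl; apply/seteqP; split => // z [/= zk zl]; move: kl; rewrite -zk -zl eqxx.
have sA C n : <<s cylinders Z (K n) >> (A C n).
  suff : measurable (A C n : set (g_sigma_algebraType (cylinders Z (K n)))) by [].
  by apply: measurable_exceed => i; [exact: generated_by_U|exact: generated_by_V].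
(* Otherwise, almost surely, for every C the events [A C n] recur infinitely often, including the C
   that bounds T_n at the given point. *)
have [C hC] : exists C, bounded_sums (fun n => prob P (A C n)).
  apply: contrapT => nb; apply: (@ae_not_false _ _ _ P).
  have h C : {ae P, forall t, forall N, exists2 k, (N <= k)%N & A C k t}.
    apply: (borel_cantelli2 (measurable_pairUV U V) (independent_pairUV iidUV) dK (sA C)).
    by move=> b; apply: nb; exists C.
  have := ae_foralln h; apply: filterS2 ae_Tn_bounded => t [m hm] /(_ m (m + 1)%N)[n mn].
  move=> [i iq [j jq /andP[ij]]]; apply/negP; rewrite -ltNge.
  have [i1 i2] : (i < p n)%N /\ (i < p n.+1)%N by move: iq; rewrite /q leq_min => /andP.
  have [j1 j2] : (j < p n)%N /\ (j < p n.+1)%N by move: jq; rewrite /q leq_min => /andP.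
  have E : U n i t * V n j t = \sum_(0 <= k < n.+1) prodUV U V i j k t -
      \sum_(0 <= k < n) prodUV U V i j k t.
    by rewrite big_nat_recr//= addrAC subrr add0r.
  rewrite /= E; apply: (le_lt_trans (ler_normB _ _)).
  have h1 := le_trans (le_Tn t i1 j1 ij) (hm n ltac:(lia)).
  have h2 := le_trans (le_Tn t i2 j2 ij) (hm n.+1 ltac:(lia)).
  have h3 : m%:R * nrm n <= m%:R * nrm n.+1 :> R by rewrite ler_wpM2l// le_nrm.
  have h4 : 0 < nrm n.+1 :> R by rewrite nrm_gt0//; lia.
  rewrite natrD natrM mulrDl mul1r -mulrA mulr2n mulrDl !mul1r.
  by move: h1 h2 h3 h4; lra.
have [a ha] := pow2_gt c2.
have [b hb] := pow2_gt ((2 * C + 1)%:R ^+ 2 : R).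
(* [a] accounts for p n >= n / c2, [b] for the factor 2 C + 1, and the additional 1 for n + 1 <=
   2^(k+1). *)
exists (a + b.+1)%N.
have C0 : (0 : R) < (2 * C + 1)%:R by rewrite ltr0n addn1.
have : bounded_sums (fun k => (2 ^ k)%:R * pe (2 ^ (k - a)) (nrm (2 ^ (k + b.+1)))).
  apply: bounded_sums_condense hC => [n|k n /andP[kn nk]]; first exact: prob_ge0.
  rewrite (prob_exceed_at iidUV _ _ (@row_inj n) (@row_inj 0)).
  apply: prob_le; [exact: measurable_exceed_at..|].
  apply: exceed_mono.
    have pge l : (2 ^ k <= l)%N -> (2 ^ (k - a) <= p l)%N.
      move=> kl; have l0 : (0 < l)%N by rewrite (leq_trans _ kl)// expn_gt0.
      have [ka|ak] := leqP k a.
        by rewrite (_ : k - a = 0)%N ?p_gt0//; lia.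
      have pl0 : (0 : R) < (p l)%:R by rewrite ltr0n p_gt0.
      have := p_ge l0; rewrite ler_pdivrMr// => h.
      have h2 : (2 ^ k)%:R <= (2 ^ a)%:R * (p l)%:R :> R.
        apply: (@le_trans _ _ l%:R); first by rewrite ler_nat.
        by apply: (le_trans h); rewrite ler_wpM2r// ltW.
      move: h2; rewrite -natrM ler_nat -{1}(subnKC (ltnW ak)) expnD leq_mul2l.
      by rewrite expn_eq0.
    by rewrite /q leq_min !pge// (leq_trans kn).
  apply: (@le_trans _ _ ((2 * C + 1)%:R * nrm (2 ^ k.+1))); first by rewrite ler_wpM2l// le_nrm.
  rewrite -(addSnnS k b) -ler_pdivlMl//.
  apply: nrm_pow2_scale; first by rewrite invr_ge0.
  by rewrite exprVn ler_pdivlMl ?exprn_gt0// mulr1 ltW.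
move=> /(@bounded_sums_unshift _ _ a (fun k => mulr_ge0 (ler0n _ _) (prob_ge0 _ _))).
apply: (bounded_sums_le (C := 1) (N := 0)) => //.
  by move=> k; rewrite mulr_ge0// prob_ge0.
move=> k _; rewrite mul1r addKn addnCA addnA ler_wpM2r ?prob_ge0// ler_nat leq_exp2l//.
exact: leq_addl.
Qed.

Lemma mean_eq0_of_limsup : L1 P (fun t => `|U 0 0 t| ^+ 3) ->
  L1 P (fun t => `|V 0 0 t| ^+ 3) -> mean P (U 0 0) * mean P (V 0 0) = 0.
Proof.
move=> iU3 iV3; apply: contrapT => /eqP; set mu := _ * _ => mu0.
have iU : L1 P (U 0 0) := L1_of_cube (n := 1) isT (measurable_funP _) iU3.
have iV : L1 P (V 0 0) := L1_of_cube (n := 1) isT (measurable_funP _) iV3.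
have iU2 := L1_of_cube (n := 2) isT (measurable_funP (U 0 0)) iU3.
have iV2 := L1_of_cube (n := 2) isT (measurable_funP (V 0 0)) iV3.
have m1 : measurable_fun setT (id : R -> R) by exact: measurable_id.
have m2 : measurable_fun setT (fun x : R => x ^+ 2) by exact: measurable_funX.
set s2 := mean P (fun t => U 0 0 t ^+ 2) * mean P (fun t => V 0 0 t ^+ 2).
pose X k t := prodUV U V 0 1 k t - mu.
have gX k : generated_by Z (pair_cells 0 1 k) (X k).
  by apply: measurable_funB => //; exact: generated_by_prodUV.
have hX k : [/\ L1 P (X k), L1 P (fun t => X k t ^+ 2), mean P (X k) = 0 &
    mean P (fun t => X k t ^+ 2) <= s2].
  have [i1 e1] := product_moment iidUV k (isT : (0 != 1)%N) m1 m1 iU iV.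
  have [i2 e2] := product_moment iidUV k (isT : (0 != 1)%N) m2 m2 iU2 iV2.
  have sq t : X k t ^+ 2 = U k 0 t ^+ 2 * V k 1 t ^+ 2 + - (2 * mu) * (U k 0 t * V k 1 t) + mu ^+ 2.
    by rewrite /X /prodUV; ring.
  have iC := L1_cst P (mu ^+ 2).
  have iB := L1Z (- (2 * mu)) i1.
  have iS := L1D i2 iB.
  split.
  - exact: L1D i1 (L1_cst P (- mu)).
  - by under eq_fun do rewrite sq; exact: L1D.
  - have := meanD i1 (L1_cst P (- mu)); rewrite mean_cst e1 -/mu subrr; exact.
  - under eq_fun do rewrite sq.
    rewrite meanD// meanD// meanZ// mean_cst e1 e2 -/mu -/s2.
    by have := sqr_ge0 mu; lra.
have := fun n => mean_sum_sq (measurable_pairUV U V) (independent_pairUV iidUV)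
  (@pair_cells_disjoint 0 1) n gX hX.
move=> hsum.
have s20 : 0 <= s2.
  by rewrite mulr_ge0// mean_ge0// => t; rewrite sqr_ge0.
(* The centred sum deviates by at least half of the drift; Chebyshev's bound 4 s2 / (mu^2 2^k) is
   summable because only powers of 2 are used. *)
pose D k := [set t | ((2 ^ k)%:R * mu / 2) ^+ 2 <= (\sum_(0 <= h < 2 ^ k) X h t) ^+ 2].
have mD k : measurable (D k) by apply: measurable_ge; exact: L1_measurable (hsum _).1.
have bD : bounded_sums (fun k => prob P (D k)).
  apply: (bounded_sums_le (C := 4 * s2 / mu ^+ 2) (N := 0) (v := fun k => 2^-1 ^+ k)).
  - by rewrite divr_ge0 ?sqr_ge0// mulr_ge0.
  - by move=> k; rewrite exprn_ge0.
  - move=> k _; have [i2 e2] := hsum (2 ^ k)%N.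
    have K0 : (0 : R) < (2 ^ k)%:R by rewrite ltr0n expn_gt0.
    have a0 : 0 < ((2 ^ k)%:R * mu / 2) ^+ 2.
      by rewrite exprn_even_gt0//= mulf_neq0 ?invr_eq0 ?pnatr_eq0// mulf_neq0// gt_eqF.
    apply: (le_trans (mean_markov a0 i2 (fun t => sqr_ge0 _))).
    rewrite ler_pdivrMr//; apply: (le_trans e2).
    rewrite exprVn -natrX le_eqVlt; apply/orP; left; apply/eqP.
    by field; rewrite mu0 gt_eqF.
  - by apply: bounded_sums_geometric; lra.
apply: (@ae_not_false _ _ _ P).
apply: filterS2 ae_Tn_bounded (borel_cantelli mD bD) => t [m hm] [N hN].
have [a ha] := pow2_gt (2 * c2).
have [k0 hk0] := linear_lt_pow2 (4 * m%:R ^+ 2 / mu ^+ 2).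
pose k := (m + N + a + k0)%N.
have mk : (m <= k)%N by rewrite /k -!addnA leq_addr.
have Nk : (N <= k)%N by rewrite /k -!addnA addnCA leq_addr.
have ak : (a <= k)%N by rewrite /k addnAC leq_addl.
have K0 : (0 : R) < (2 ^ k)%:R by rewrite ltr0n expn_gt0.
have kK : (k < 2 ^ k)%N by exact: ltn_expl.
(* The columns 0 and 1 must both be below p(2^k) for [Tmax] to dominate their sum. *)
have p2 : (1 < p (2 ^ k))%N.
  have n0 : (0 < 2 ^ k)%N by rewrite expn_gt0.
  have pl0 : (0 : R) < (p (2 ^ k))%:R by rewrite ltr0n p_gt0.
  have := p_ge n0; rewrite ler_pdivrMr// => h.
  rewrite ltnNge; apply/negP => ple1.
  have : (2 ^ a)%:R <= c2.
    apply: (@le_trans _ _ (2 ^ k)%:R); first by rewrite ler_nat leq_exp2l.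
    apply: (le_trans h); rewrite ler_piMr ?lern1//.
    by have := p_ge n0; apply: le_trans; rewrite divr_ge0.
  have c20 : 0 <= c2 by have := p_ge n0; apply: le_trans; rewrite divr_ge0.
  by move: ha c20; lra.
have h1 := le_trans (le_Tn t (ltnW p2) p2 (isT : (0 != 1)%N)) (hm (2 ^ k)%N (leq_trans mk (ltnW kK))).
have := hN k Nk; rewrite /D /= => /negP; rewrite -ltNge.
have -> : \sum_(0 <= h < 2 ^ k) X h t =
    \sum_(0 <= h < 2 ^ k) prodUV U V 0 1 h t - (2 ^ k)%:R * mu.
  by rewrite /X sumrB sumr_const_nat subn0 mulr_natl.
move: h1; set Sn := \sum_(0 <= h < 2 ^ k) _ => h1 h2.
have h3 : Sn ^+ 2 <= m%:R ^+ 2 * ((2 ^ k)%:R * k%:R).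
  apply: (@le_trans _ _ ((m%:R * nrm (2 ^ k)) ^+ 2)).
    by rewrite -[leLHS]real_normK ?num_real// ler_sqr ?nnegrE ?mulr_ge0 ?nrm_ge0.
  by rewrite exprMn ler_wpM2l ?sqr_ge0// nrm_pow2_sq_le.
have h4 := hk0 k (leq_addl _ _).
have mu2 : 0 < mu ^+ 2 by rewrite exprn_even_gt0.
have h5 : 4 * m%:R ^+ 2 * k%:R <= (2 ^ k)%:R * mu ^+ 2.
  by move: h4; rewrite mulrAC ler_pdivrMr.
have h6 : 4 * Sn ^+ 2 <= ((2 ^ k)%:R * mu) ^+ 2.
  have : (2 ^ k)%:R * (4 * m%:R ^+ 2 * k%:R) <= (2 ^ k)%:R * ((2 ^ k)%:R * mu ^+ 2).
    by rewrite ler_wpM2l.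
  have -> : ((2 ^ k)%:R * mu) ^+ 2 = (2 ^ k)%:R * ((2 ^ k)%:R * mu ^+ 2) by ring.
  by move: h3; lra.
move: h2 h6; set Y := _ * mu => h2 h6.
(* A number within |Y| / 2 of Y has absolute value above |Y| / 2, against [h6]; the square gives
   this without treating the sign of Y. *)
have : 0 <= (2 * Sn - Y) ^+ 2 by exact: sqr_ge0.
by move: h2 h6; rewrite !expr2; lra.
Qed.

End converse.

Lemma ae_sq_eq0 {d} {T : measurableType d} {R : realType} (P : probability T R)
    (X : {RV P >-> R}) : {ae P, forall t, X t = 0} -> ('E_P[fun t => (X t ^+ 2)%R] = 0)%E.
Proof.
move=> X0; apply: expectation_ae0; first exact: measurable_funX.
by apply: filterS X0 => t ->; rewrite expr0n.
Qed.

Lemma dyadic_swap {d} {T : measurableType d} {R : realType} (P : probability T R)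
    (U V : nat -> nat -> {RV P >-> R}) (s : nat) :
  bounded_sums (fun k => (2 ^ k)%:R *
    prob P (exceed_at U V (row 0) (2 ^ k) (nrm (2 ^ (k + s))))) ->
  bounded_sums (fun k => (2 ^ k)%:R *
    prob P (exceed_at V U (row 0) (2 ^ k) (nrm (2 ^ (k + s))))).
Proof. by under eq_fun do rewrite -exceed_at_swap. Qed.

Theorem theorem3p3 (R : realType) (d : measure_display) (T : measurableType d)
  (P : probability T R) (U V : nat -> nat -> {RV P >-> R}) (p : nat -> nat) :
  iid_array P (fun k i => U k i) (fun k i => V k i) ->
  (forall n, (0 < n)%N -> (0 < p n)%N) ->
  (exists c1 c2 : R, 0 < c1 /\
     forall n, (0 < n)%N -> c1 <= n%:R / (p n)%:R <= c2) ->
  (* (a) *)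
  (('E_P[U 0%N 0%N] * 'E_P[V 0%N 0%N] = 0)%E ->
   ('E_P[fun t => (U 0%N 0%N t ^+ 2)%R] * 'E_P[fun t => (V 0%N 0%N t ^+ 2)%R] = 1)%E ->
   (\sum_(1 <= n <oo) P [set t | (nrm n <= Mn (fun k i => U k i) (fun k i => V k i) n t)%R]
      < +oo)%E ->
   {ae P, forall t, (limn_esup (fun n =>
       (Tn (fun k i => U k i) (fun k i => V k i) p n t / nrm n)%:E) <= 2%:E)%E})
  /\
  (* (b) *)
  ({ae P, forall t, (limn_esup (fun n =>
       (Tn (fun k i => U k i) (fun k i => V k i) p n t / nrm n)%:E) < +oo)%E} ->
   [/\ ('E_P[U 0%N 0%N] * 'E_P[V 0%N 0%N] = 0)%E,
       ('E_P[fun t => (U 0%N 0%N t ^+ 2)%R] * 'E_P[fun t => (V 0%N 0%N t ^+ 2)%R] < +oo)%E &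
       (\sum_(1 <= n <oo) P [set t | (nrm n <= Mn (fun k i => U k i) (fun k i => V k i) n t)%R]
          < +oo)%E]).
Proof.
move=> iidUV p_gt0 [c1 [c2 [c1_gt0 hp]]].
have p_le n : (0 < n)%N -> c1 <= n%:R / (p n)%:R by move=> /hp/andP[].
have p_ge n : (0 < n)%N -> n%:R / (p n)%:R <= c2 by move=> /hp/andP[].
have cubes s a b : bounded_sums (fun k => (2 ^ k)%:R *
      prob P (exceed_at U V (row 0) (2 ^ k) (nrm (2 ^ (k + s))))) ->
    0 < a -> 0 < prob P [set t | a <= `|U 0%N 0%N t|] ->
    0 < b -> 0 < prob P [set t | b <= `|V 0%N 0%N t|] ->
    L1 P (fun t => `|U 0%N 0%N t| ^+ 3) /\ L1 P (fun t => `|V 0%N 0%N t| ^+ 3).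
  move=> dy a0 pa b0 pb; split; first exact: (L1_cube_of_dyadic iidUV dy b0 pb).
  exact: (L1_cube_of_dyadic (iid_array_swap iidUV) (dyadic_swap dy) a0 pa).
have mU : measurable_fun setT (U 0%N 0%N) by [].
have mV : measurable_fun setT (V 0%N 0%N) by [].
split.
- move=> mean0 var1 /dyadic_of_series dy.
  (* A factor vanishing almost surely would make the product of second moments 0 instead of 1. *)
  have [U0|[a a0 pa]] := ae_zero_or_tail P mU.
    by move: var1; rewrite (ae_sq_eq0 U0) mul0e => -[/eqP]; rewrite eq_sym oner_eq0.
  have [V0|[b b0 pb]] := ae_zero_or_tail P mV.
    by move: var1; rewrite (ae_sq_eq0 V0) mule0 => -[/eqP]; rewrite eq_sym oner_eq0.
  have [iU3 iV3] := cubes _ a b dy a0 pa b0 pb.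
  have iU : L1 P (U 0%N 0%N) := L1_of_cube (n := 1) isT mU iU3.
  have iV : L1 P (V 0%N 0%N) := L1_of_cube (n := 1) isT mV iV3.
  have iU2 := L1_of_cube (n := 2) isT mU iU3.
  have iV2 := L1_of_cube (n := 2) isT mV iV3.
  apply: (ae_limsup_Tn_le iidUV iU3 iV3 _ _ (dyadic_transfer iidUV dy) c1_gt0 p_gt0 p_le).
  + by apply: EFin_inj; rewrite EFinM -!expectation_mean.
  + by apply: EFin_inj; rewrite EFinM -!expectation_mean.
- move=> hlim.
  have [s dy] := dyadic_of_limsup iidUV p_gt0 p_ge hlim.
  have series := series_of_dyadic iidUV dy.
  (* In the degenerate cases the expectations of the other factor may be infinite; the extended
     products are still 0. *)
  have [U0|[a a0 pa]] := ae_zero_or_tail P mU.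
    by rewrite (expectation_ae0 mU U0) (ae_sq_eq0 U0) !mul0e; split.
  have [V0|[b b0 pb]] := ae_zero_or_tail P mV.
    by rewrite (expectation_ae0 mV V0) (ae_sq_eq0 V0) !mule0; split.
  have [iU3 iV3] := cubes _ a b dy a0 pa b0 pb.
  have iU : L1 P (U 0%N 0%N) := L1_of_cube (n := 1) isT mU iU3.
  have iV : L1 P (V 0%N 0%N) := L1_of_cube (n := 1) isT mV iV3.
  have iU2 := L1_of_cube (n := 2) isT mU iU3.
  have iV2 := L1_of_cube (n := 2) isT mV iV3.
  split => //.
  + rewrite !expectation_mean// -EFinM.
    by rewrite (mean_eq0_of_limsup iidUV p_gt0 p_ge hlim iU3 iV3).
  + by rewrite !expectation_mean// -EFinM ltry.
Qed.
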